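(* Let $\rho,\gamma\in\mathrm{Aut}(\mathbb{Q},<)$. The following are equivalent: (1) $\gamma\in\mathcal{C}_\rho$; (2) for every finite $A\subseteq\mathbb{Q}$, putting $p=\gamma\restriction A$, there is a $\wp$-homomorphism $\phi:(A/\sim_p,\prec,\wp_p)\to(\mathcal{O}_\rho,\prec,\wp_\rho)$; (3) $\mathcal{O}_\rho$ is of type $\infty_{+,-,0}$, or both $\mathcal{O}_\gamma$ and $\mathcal{O}_\rho$ are not of type $\infty_{+,-,0}$ and there is a $\chi$-homomorphism from the canonical $\chi$-colored ordering $(\mathcal{L}_\gamma,\prec,\hat\wp_\gamma)$ of $(\mathcal{O}_\gamma,\prec,\wp_\gamma)$ to the canonical $\chi$-colored ordering $(\mathcal{L}_\rho,\prec,\hat\wp_\rho)$ of $(\mathcal{O}_\rho,\prec,\wp_\rho)$.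
   Context: $\mathrm{Aut}(\mathbb{Q},<)$ carries the topology of pointwise convergence; $\mathcal{C}_\rho$ is the topological closure of $\{\sigma\rho\sigma^{-1}:\sigma\in\mathrm{Aut}(\mathbb{Q},<)\}$. Orbitals: for $\gamma$ and $x\in\mathbb{Q}$ the orbital of $\gamma$ containing $x$ is $\{q:\exists m,n\in\mathbb{Z},\ \gamma^n(x)\le q\le\gamma^m(x)\}$; the parity $\wp_\gamma(x)$ is $+,0,-$ according as $\gamma(x)>x$, $=x$, $<x$ (constant on orbitals). $\mathcal{O}_\gamma$ is the set of orbitals, ordered by $I\prec J$ iff $a<b$ for all $a\in I,b\in J$, and colored by parity. Partial orbitals: for a finite partial isomorphism $p$ of $(\mathbb{Q},<)$ and $a\in\mathrm{Dom}(p)\cup\mathrm{Rng}(p)$, $\wp_p(a)$ is the sign of $p(a)-a$ (if $a\in\mathrm{Dom}(p)$) or of $a-p^{-1}(a)$ (if $a\in\mathrm{Rng}(p)$). Elements $a,b\in\mathbb{Q}$ are $p$-related if $a=b$, or if $\wp_p(a)=+$ or $\wp_p(b)=+$ and one of $a\le b\le p(a)$, $b\le a\le p(b)$, $p^{-1}(a)\le b\le a$, $p^{-1}(b)\le a\le b$ holds, or if $\wp_p(a)=-$ or $\wp_p(b)=-$ and one of $a\le b\le p^{-1}(a)$, $b\le a\le p^{-1}(b)$, $p(a)\le b\le a$, $p(b)\le a\le b$ holds (whenever the values are defined). $\sim_p$ is the equivalence relation generated by $p$-relatedness; for $A\subseteq\mathbb{Q}$, $A/\sim_p$ is the set of $\sim_p$-classes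 of elements of $A$, ordered by $\prec$ and colored by $\wp_p$. A $\wp$-homomorphism (= $\kappa$-homomorphism) between $\{+,-,0\}$-colored linear orderings is a color-preserving map $\phi$ with $x\le y\Rightarrow\phi(x)\le\phi(y)$ that is injective on elements of color $0$. Types: for a $\{+,-,0\}$-colored linear order $(L,\le,\kappa)$ and convex $L_0\subseteq L$: type $\infty_{+,-,0}$ means for every $n$ there are $a_1<\dots<a_{3(n+1)}$ in $L_0$ with colors cycling $+,-,0$; type $\varepsilon\in\{+,-,0\}$ means $\kappa(L_0)=\{\varepsilon\}$ and, for $\varepsilon=0$, $|L_0|=1$; type $\infty_0$ means $L_0$ infinite of constant color $0$; type $\infty_{\varepsilon_1\varepsilon_2}$ ($\varepsilon_1\varepsilon_2\in\{+-,+0,-0\}$) means $\kappa(L_0)=\{\varepsilon_1,\varepsilon_2\}$ and for every $n$ there are $a_1<\dots<a_{2(n+1)}$ in $L_0$ alternating $\varepsilon_1,\varepsilon_2$. $\chi=\{\{+\},\{-\},\{0\},\infty_0,\infty_{+-},\infty_{+0},\infty_{-0}\}$, partially ordered by $\subseteq$ generated by $\{\varepsilon\}\subseteq\infty_{\varepsilon_1\varepsilon_2}$ for $\varepsilon\in\{\varepsilon_1,\varepsilon_2\}$, $\{0\}\subseteq\infty_0\subseteq\infty_{+0}$, $\infty_0\subseteq\infty_{-0}$. A decomposition of $L$ into finitely many intervals $L_1\prec\dots\prec L_n$ of types among $+,-,0,\infty_0,\infty_{+-},\infty_{+0},\infty_{-0}$ yields the $\chi$-colored ordering $(\{L_i\},\prec,\hat\kappa)$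 with $\hat\kappa(L_i)=\{\tau\}$ for type $\tau\in\{+,-,0\}$ and $\hat\kappa(L_i)=\tau$ otherwise. A finite $\chi$-colored ordering is canonical if for all $x,y$: (1) $x\ne y$ and $\hat\kappa(x)\subseteq\hat\kappa(y)$ imply some element lies strictly between them; (2) if some element lies strictly between $x,y$ and $\hat\kappa(x)=\infty_{\varepsilon_1\varepsilon_2}$, $\hat\kappa(y)=\infty_{\varepsilon_1'\varepsilon_2'}$ with $\varepsilon_1\varepsilon_2\ne\varepsilon'_1\varepsilon'_2$, then (a) there are $z_1,z_2$ with $x<z_1<z_2<y$ or $y<z_1<z_2<x$ and $\hat\kappa(z_1)\ne\hat\kappa(z_2)$ both in $\{\{+\},\{-\},\{0\},\infty_0,\infty_{\varepsilon_1\varepsilon_2},\infty_{\varepsilon'_1\varepsilon'_2}\}$, or (b) some $z$ strictly between $x,y$ has $\hat\kappa(z)=\infty_{\varepsilon\varepsilon'}$ with $\{\varepsilon\}\not\subseteq\hat\kappa(x)$, $\{\varepsilon'\}\not\subseteq\hat\kappa(y)$. For $L$ not of type $\infty_{+,-,0}$ a decomposition with canonical associated $\chi$-colored ordering exists and this ordering is unique up to isomorphism; it is the canonical $\chi$-colored ordering of $L$. A $\chi$-homomorphism $\phi:(\mathcal{L},<,\hat\kappa)\to(\mathcal{L}',<',\hat\kappa')$ satisfies $x_1\le x_2\Rightarrow\phi(x_1)\le'\phi(x_2)$ and $\hat\kappa(x)\subseteq\hat\kappa'(\phi(x))$. *)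

(* Defs.v *)
From mathcomp Require Import all_boot all_order all_algebra.
From Stdlib Require Import ClassicalEpsilon Relation_Operators.
Set Implicit Arguments.
Unset Strict Implicit.
Unset Printing Implicit Defensive.
Import Order.TTheory GRing.Theory Num.Theory.
Local Open Scope ring_scope.

Record autQ := AutQ {
  af :> rat -> rat;
  ainv : rat -> rat;
  af_incr : forall x y : rat, x < y -> af x < af y;
  af_K : forall x, ainv (af x) = x;
  ainv_K : forall x, af (ainv x) = x }.

Definition zit (g : autQ) (n : int) (x : rat) : rat :=
  match n with
  | Posz k => iter k g x
  | Negz k => iter k.+1 (ainv g) x
  end.

(** the closure C_rho of the conjugacy class of rho in the topology of
    pointwise convergence (Q discrete): every basic neighbourhood
    {delta | delta = gamma on A}, A finite, meets the conjugacy class. *)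
Definition in_conj_closure (rho gamma : autQ) : Prop :=
  forall A : seq rat, exists sigma : autQ,
    forall a, a \in A -> sigma (rho (ainv sigma a)) = gamma a.

Inductive color := Plus | Minus | Zero.

Definition sgnc (u v : rat) : color :=
  if u < v then Plus else if v < u then Minus else Zero.

Definition parity (g : autQ) (x : rat) : color := sgnc x (g x).

Definition orbital (g : autQ) (x : rat) : rat -> Prop :=
  fun q => exists m n : int, zit g n x <= q /\ q <= zit g m x.

Definition Orbitals (g : autQ) : (rat -> Prop) -> Prop :=
  fun I => exists x, I = orbital g x.

Definition setlt (I J : rat -> Prop) : Prop :=
  forall a b, I a -> J b -> a < b.

(** colour of an orbital (the parity, constant on orbitals) *)
Definition ocol (g : autQ) (I : rat -> Prop) : color :=
  if excluded_middle_informative (exists x, I x /\ x < g x) then Plus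
  else if excluded_middle_informative (exists x, I x /\ g x < x) then Minus
  else Zero.

(** * Partial orbitals of p = gamma restricted to a finite A *)
Section PartialOrbitals.
Variables (g : autQ) (A : seq rat).

Definition inDom (a : rat) : Prop := a \in A.
Definition inRng (a : rat) : Prop := ainv g a \in A.

Definition ppar (a : rat) : option color :=
  if a \in A then Some (sgnc a (g a))
  else if ainv g a \in A then Some (sgnc (ainv g a) a)
  else None.

Definition prel (a b : rat) : Prop :=
  a = b
  \/ ((ppar a = Some Plus \/ ppar b = Some Plus) /\
      ((inDom a /\ a <= b /\ b <= g a)
       \/ (inDom b /\ b <= a /\ a <= g b)
       \/ (inRng a /\ ainv g a <= b /\ b <= a)
       \/ (inRng b /\ ainv g b <= a /\ a <= b)))
  \/ ((ppar a = Some Minus \/ ppar b = Some Minus) /\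
      ((inRng a /\ a <= b /\ b <= ainv g a)
       \/ (inRng b /\ b <= a /\ a <= ainv g b)
       \/ (inDom a /\ g a <= b /\ b <= a)
       \/ (inDom b /\ g b <= a /\ a <= b))).

Definition psim : rat -> rat -> Prop := clos_refl_sym_trans rat prel.

Definition pclass (a : rat) : rat -> Prop := fun q => psim a q.
End PartialOrbitals.

(** (2): a wp-homomorphism (A/~_p, <, wp_p) -> (O_rho, <, wp_rho), p = gamma|A;
    a map on classes, i.e. on the sets [a] for a in A. *)
Definition wp_hom_exists (rho gamma : autQ) (A : seq rat) : Prop :=
  exists phi : (rat -> Prop) -> (rat -> Prop),
    (forall a, a \in A -> Orbitals rho (phi (pclass gamma A a)))
    /\ (forall a, a \in A -> ppar gamma A a = Some (ocol rho (phi (pclass gamma A a))))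
    /\ (forall a b, a \in A -> b \in A ->
          (pclass gamma A a = pclass gamma A b \/ setlt (pclass gamma A a) (pclass gamma A b)) ->
          (phi (pclass gamma A a) = phi (pclass gamma A b)
           \/ setlt (phi (pclass gamma A a)) (phi (pclass gamma A b))))
    /\ (forall a b, a \in A -> b \in A ->
          ppar gamma A a = Some Zero -> ppar gamma A b = Some Zero ->
          phi (pclass gamma A a) = phi (pclass gamma A b) ->
          pclass gamma A a = pclass gamma A b).

Section Types.
Variables (T : Type) (lt : T -> T -> Prop) (kappa : T -> color).

Definition cyc3 (i : nat) : color :=
  match (i %% 3)%N with 0 => Plus | 1 => Minus | _ => Zero end.

Definition type_inf3 (L0 : T -> Prop) : Prop :=
  forall n : nat, exists a : nat -> T,
    (forall i, (i < 3 * n.+1)%N -> L0 (a i))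
    /\ (forall i, (i.+1 < 3 * n.+1)%N -> lt (a i) (a i.+1))
    /\ (forall i, (i < 3 * n.+1)%N -> kappa (a i) = cyc3 i).

Definition type_single (e : color) (L0 : T -> Prop) : Prop :=
  (exists x, L0 x)
  /\ (forall x, L0 x -> kappa x = e)
  /\ (e = Zero -> forall x y, L0 x -> L0 y -> x = y).

Definition infinite_set (L0 : T -> Prop) : Prop :=
  forall n : nat, exists a : nat -> T,
    (forall i, (i < n)%N -> L0 (a i))
    /\ (forall i j, (i < n)%N -> (j < n)%N -> a i = a j -> i = j).

Definition type_inf0 (L0 : T -> Prop) : Prop :=
  infinite_set L0 /\ (forall x, L0 x -> kappa x = Zero).

Definition type_inf2 (e1 e2 : color) (L0 : T -> Prop) : Prop :=
  (forall x, L0 x -> kappa x = e1 \/ kappa x = e2)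
  /\ (exists x, L0 x /\ kappa x = e1)
  /\ (exists x, L0 x /\ kappa x = e2)
  /\ (forall n : nat, exists a : nat -> T,
        (forall i, (i < 2 * n.+1)%N -> L0 (a i))
        /\ (forall i, (i.+1 < 2 * n.+1)%N -> lt (a i) (a i.+1))
        /\ (forall i, (i < 2 * n.+1)%N -> kappa (a i) = if odd i then e2 else e1)).
End Types.

Inductive chi := Cp | Cm | C0 | Cinf0 | Cpm | Cp0 | Cm0.

Definition csingle (e : color) : chi :=
  match e with Plus => Cp | Minus => Cm | Zero => C0 end.

(** oo_{e e'} for an (unordered) pair of distinct colours *)
Definition cpair (e e' : color) : chi :=
  match e, e' with
  | Plus, Minus | Minus, Plus => Cpm
  | Plus, Zero | Zero, Plus => Cp0
  | _, _ => Cm0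
  end.

Definition is_pair (c : chi) : bool :=
  match c with Cpm | Cp0 | Cm0 => true | _ => false end.

Definition chi_sub (c d : chi) : bool :=
  match c, d with
  | Cp, (Cp | Cpm | Cp0) => true
  | Cm, (Cm | Cpm | Cm0) => true
  | C0, (C0 | Cinf0 | Cp0 | Cm0) => true
  | Cinf0, (Cinf0 | Cp0 | Cm0) => true
  | Cpm, Cpm | Cp0, Cp0 | Cm0, Cm0 => true
  | _, _ => false
  end.

Definition has_type (T : Type) (lt : T -> T -> Prop) (kappa : T -> color)
    (c : chi) (L0 : T -> Prop) : Prop :=
  match c with
  | Cp => type_single kappa Plus L0
  | Cm => type_single kappa Minus L0
  | C0 => type_single kappa Zero L0
  | Cinf0 => type_inf0 kappa L0
  | Cpm => type_inf2 lt kappa Plus Minus L0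
  | Cp0 => type_inf2 lt kappa Plus Zero L0
  | Cm0 => type_inf2 lt kappa Minus Zero L0
  end.

(** A decomposition of L into intervals Ls_0 < ... < Ls_(n-1) of types cs_i;
    its associated chi-coloured ordering is the finite ordering cs
    (indices ordered naturally, index i coloured cs_i). *)
Definition decomposition (T : Type) (L : T -> Prop) (lt : T -> T -> Prop)
    (kappa : T -> color) (Ls : seq (T -> Prop)) (cs : seq chi) : Prop :=
  let Li i := nth (fun _ => False) Ls i in
  size Ls = size cs
  /\ (forall x, L x -> exists i, (i < size Ls)%N /\ Li i x)
  /\ (forall i x, (i < size Ls)%N -> Li i x -> L x)
  /\ (forall i j x, (i < size Ls)%N -> (j < size Ls)%N -> i <> j -> Li i x -> Li j x -> False)
  /\ (forall i j x y, (i < j)%N -> (j < size Ls)%N -> Li i x -> Li j y -> lt x y)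
  /\ (forall i x y z, (i < size Ls)%N -> Li i x -> Li i z -> L y -> lt x y -> lt y z -> Li i y)
  /\ (forall i, (i < size Ls)%N -> has_type lt kappa (nth Cp cs i) (Li i)).

Definition strictly_between (z x y : nat) : bool :=
  (((x < z) && (z < y)) || ((y < z) && (z < x)))%N.

Definition canonical (cs : seq chi) : Prop :=
  let c i := nth Cp cs i in
  let n := size cs in
  forall x y, (x < n)%N -> (y < n)%N ->
    ((x <> y -> chi_sub (c x) (c y) ->
        exists z, (z < n)%N /\ strictly_between z x y)
     /\ ((exists z, (z < n)%N /\ strictly_between z x y) ->
         is_pair (c x) -> is_pair (c y) -> c x <> c y ->
         (exists z1 z2, (z1 < n)%N /\ (z2 < n)%N /\
            (((x < z1) && (z1 < z2) && (z2 < y))%N \/ ((y < z1) && (z1 < z2) && (z2 < x))%N)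
            /\ c z1 <> c z2
            /\ List.In (c z1) [:: Cp; Cm; C0; Cinf0; c x; c y]
            /\ List.In (c z2) [:: Cp; Cm; C0; Cinf0; c x; c y])
         \/ (exists z e e', (z < n)%N /\ strictly_between z x y /\ e <> e' /\
               c z = cpair e e' /\
               ~~ chi_sub (csingle e) (c x) /\ ~~ chi_sub (csingle e') (c y)))).

Definition chi_hom (cs ds : seq chi) : Prop :=
  exists phi : nat -> nat,
    (forall i, (i < size cs)%N -> (phi i < size ds)%N)
    /\ (forall i j, (i <= j)%N -> (j < size cs)%N -> (phi i <= phi j)%N)
    /\ (forall i, (i < size cs)%N -> chi_sub (nth Cp cs i) (nth Cp ds (phi i))).

Definition O_inf3 (g : autQ) : Prop := type_inf3 setlt (ocol g) (Orbitals g).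

Definition O_decomp (g : autQ) (Ls : seq ((rat -> Prop) -> Prop)) (cs : seq chi) : Prop :=
  decomposition (Orbitals g) setlt (ocol g) Ls cs.

Definition cond3 (rho gamma : autQ) : Prop :=
  O_inf3 rho
  \/ (~ O_inf3 gamma /\ ~ O_inf3 rho /\
      exists Lg cg Lr cr,
        O_decomp gamma Lg cg /\ canonical cg /\
        O_decomp rho Lr cr /\ canonical cr /\
        chi_hom cg cr).

(* Main.v *)
(* All three conditions say that every finite family of orbitals of [gamma] maps, weakly monotonically,
   colour by colour and injectively on fixed points, to orbitals of [rho]. Given such a map, the finite
   set [A] together with its image is embedded orbital by orbital into [rat] so that [gamma] becomes
   [rho]; inside a moved orbital this is always possible by a greedy construction. For the canonical
   orderings, a colouring that does not repeat [+ - 0] arbitrarily often is cut according to how much of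
   [(+ - 0)^n] has been read, each part misses a colour, and cutting parts again along [(e1 e2)^n]
   yields pieces of the allowed types; a decomposition with the fewest pieces is canonical. A long
   generic word of the pieces of [gamma], mapped to [rho], has by the pigeonhole principle a long enough
   stretch of each block inside one piece of [rho], and this defines the [chi]-homomorphism. *)
Require Import Defs.
From mathcomp Require Import all_boot all_order all_algebra.
From Stdlib Require Import ClassicalEpsilon FunctionalExtensionality PropExtensionality.
From Stdlib Require Import Relation_Operators.
From mathcomp Require Import zify ring lra.
Set Implicit Arguments.
Unset Strict Implicit.
Unset Printing Implicit Defensive.

(** * Extensionality and choice *)

Lemma pred_ext (T : Type) (P Q : T -> Prop) : (forall x, P x <-> Q x) -> P = Q.
Proof.
by move=> PQ; apply: functional_extensionality => x; apply: propositional_extensionality.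
Qed.

Lemma choice_fun (A B : Type) (R : A -> B -> Prop) :
  (forall x, exists y, R x y) -> exists f, forall x, R x (f x).
Proof.
move=> exR; exists (fun x => proj1_sig (constructive_indefinite_description _ (exR x))).
by move=> x; case: constructive_indefinite_description.
Qed.

Lemma choice_fun_in (A B : Type) (b0 : B) (P : A -> Prop) (R : A -> B -> Prop) :
  (forall x, P x -> exists y, R x y) -> exists f, forall x, P x -> R x (f x).
Proof.
move=> exR; apply: (choice_fun (R := fun x y => P x -> R x y)) => x.
case: (classic (P x)) => [/exR [y Rxy]|nP]; first by exists y.
by exists b0.
Qed.

(** * Coloured linear orders *)

(** The clause [zero_gap] is special to orbitals: between two fixed points of an automorphism of the
    rationals lies a further orbital. It forces a convex set of zeros to be a singleton or
    infinite. *)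
Record colored_order (T : Type) (L : T -> Prop) (lt : T -> T -> Prop)
    (kappa : T -> color) : Prop := ColoredOrder {
  lt_irr : forall x, L x -> ~ lt x x;
  lt_tr : forall x y z, L x -> L y -> L z -> lt x y -> lt y z -> lt x z;
  lt_total : forall x y, L x -> L y -> x = y \/ lt x y \/ lt y x;
  zero_gap : forall x y, L x -> L y -> kappa x = Zero -> kappa y = Zero -> lt x y ->
    exists z, [/\ L z, lt x z & lt z y] }.

(** The hub of the proof: each of the three conditions is compared with it. The family [a] may
    repeat elements, and [phi] may depend on the family. *)
Definition fin_hom (T T' : Type) (L : T -> Prop) (lt : T -> T -> Prop)
    (kappa : T -> color) (L' : T' -> Prop) (lt' : T' -> T' -> Prop)
    (kappa' : T' -> color) : Prop :=
  forall (n : nat) (a : nat -> T), (forall i, i < n -> L (a i)) ->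
  exists phi : T -> T',
    (forall i, i < n -> L' (phi (a i)) /\ kappa' (phi (a i)) = kappa (a i))
    /\ (forall i j, i < n -> j < n -> lt (a i) (a j) ->
          (phi (a i) = phi (a j) \/ lt' (phi (a i)) (phi (a j)))
          /\ (kappa (a i) = Zero -> kappa (a j) = Zero -> phi (a i) <> phi (a j))).

(** A decomposition presented by its index function: the pieces are the fibres of [f], so that
    disjointness, covering and convexity come for free. *)
Definition indexed (T : Type) (lt : T -> T -> Prop) (kappa : T -> color)
    (S : T -> Prop) (n : nat) (f : T -> nat) (c : nat -> chi) : Prop :=
  [/\ forall x, S x -> f x < n,
      forall x y, S x -> S y -> lt x y -> f x <= f y
    & forall k, k < n -> has_type lt kappa (c k) (fun x => S x /\ f x = k)].

Lemma chi_sub_refl c : chi_sub c c.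
Proof. by case: c. Qed.

Lemma chi_sub_trans c d e : chi_sub c d -> chi_sub d e -> chi_sub c e.
Proof. by case: c; case: d; case: e. Qed.

Section ColoredOrders.
Variables (T : Type) (L : T -> Prop) (lt : T -> T -> Prop) (kappa : T -> color).
Hypothesis co : colored_order L lt kappa.

Definition convex_in (S : T -> Prop) : Prop :=
  (forall x, S x -> L x)
  /\ (forall x y z, S x -> S z -> L y -> lt x y -> lt y z -> S y).

Lemma lt_asym x y : L x -> L y -> lt x y -> ~ lt y x.
Proof. by move=> Lx Ly xy yx; apply: (lt_irr co Lx); apply: (lt_tr co Lx Ly Lx). Qed.

Lemma chain_lt N (a : nat -> T) : (forall i, i < N -> L (a i)) ->
  (forall i, i.+1 < N -> lt (a i) (a i.+1)) ->
  forall i j, i < j -> j < N -> lt (a i) (a j).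
Proof.
move=> La lta i; elim=> // j IHj; rewrite ltnS leq_eqVlt => /orP[/eqP->|ij] jN; first exact: lta.
by apply: (lt_tr co _ (La j _) _ (IHj _ _) (lta _ _)) => //; try apply: La; lia.
Qed.

Lemma has_type_color c S x : has_type lt kappa c S -> S x -> chi_sub (csingle (kappa x)) c.
Proof.
case: c => /=; rewrite /type_single /type_inf0 /type_inf2.
- by move=> [_ [H _]] /H ->.
- by move=> [_ [H _]] /H ->.
- by move=> [_ [H _]] /H ->.
- by move=> [_ H] /H ->.
- by move=> [H _] /H [] ->.
- by move=> [H _] /H [] ->.
- by move=> [H _] /H [] ->.
Qed.

(** Every new point stays below [y], which leaves room for the next use of [zero_gap]. *)
Lemma zeros_between S x y n : convex_in S -> (forall z, S z -> kappa z = Zero) ->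
  S x -> S y -> lt x y ->
  exists a : nat -> T, (forall i, i <= n -> S (a i) /\ lt (a i) y)
    /\ (forall i, i < n -> lt (a i) (a i.+1)) /\ a 0 = x.
Proof.
move=> [SL Sc] S0; elim: n x => [|n IHn] x Sx Sy xy.
  by exists (fun _ => x); split=> // -[].
have [z [Lz xz zy]] := zero_gap co (SL _ Sx) (SL _ Sy) (S0 _ Sx) (S0 _ Sy) xy.
have Sz : S z by apply: (Sc x z y).
have [a [aP [alt a0]]] := IHn z Sz Sy zy.
exists (fun i => if i is k.+1 then a k else x); split; last split=> //.
  by case=> [//|i]; apply: aP.
by case=> [_|i]; [rewrite a0|apply: alt].
Qed.

(** Two distinct elements of the infinite set suffice, since [zero_gap] interpolates the rest of the
    chain. *)
Lemma inf0_chain S n : convex_in S -> type_inf0 kappa S ->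
  exists a : nat -> T, (forall i, i < n -> S (a i)) /\ (forall i, i.+1 < n -> lt (a i) (a i.+1)).
Proof.
move=> Sc [Sinf S0]; have [a [Sa inja]] := Sinf 2.
have [S0' S1'] : S (a 0) /\ S (a 1) by split; apply: Sa.
have [x [y [Sx Sy xy]]] : exists x y, [/\ S x, S y & lt x y].
  case: (lt_total co (Sc.1 _ S0') (Sc.1 _ S1')) => [/inja e|[?|?]].
  - by have := e isT isT.
  - by exists (a 0), (a 1).
  - by exists (a 1), (a 0).
have [b [bP [blt _]]] := zeros_between n Sc S0 Sx Sy xy.
exists b; split=> [i ilt|i ilt]; last by apply: blt; lia.
by case: (bP i (ltnW ilt)).
Qed.

Lemma chain_infinite S : convex_in S ->
  (forall n, exists a : nat -> T, (forall i, i < n -> S (a i)) /\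
    (forall i, i.+1 < n -> lt (a i) (a i.+1))) -> infinite_set S.
Proof.
move=> [SL _] H n; have [a [Sa alt]] := H n; exists a; split=> // i j ilt jlt eij.
have La k : k < n -> L (a k) by move=> /Sa /SL.
case: (ltngtP i j) => // ij; have := chain_lt La alt ij => /(_ _).
  by rewrite eij => /(_ jlt) /(lt_irr co (La _ jlt)).
by rewrite eij => /(_ ilt) /(lt_irr co (La _ jlt)).
Qed.

Lemma mono_inf0 S x y : convex_in S -> (forall z, S z -> kappa z = Zero) ->
  S x -> S y -> x <> y -> type_inf0 kappa S.
Proof.
move=> Sc S0 Sx Sy nxy; split=> //; apply: chain_infinite => // n.
have {x y Sx Sy nxy} [x [y [Sx Sy xy]]] : exists x y, [/\ S x, S y & lt x y].
  case: (lt_total co (Sc.1 _ Sx) (Sc.1 _ Sy)) => [//|[?|?]]; first by exists x, y.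
  by exists y, x.
have [b [bP [blt _]]] := zeros_between n Sc S0 Sx Sy xy.
exists b; split=> [i ilt|i ilt]; last by apply: blt; lia.
by case: (bP i (ltnW ilt)).
Qed.

Lemma level_convex S (f : T -> nat) k : convex_in S ->
  (forall x y, S x -> S y -> lt x y -> f x <= f y) ->
  convex_in (fun x => S x /\ f x = k).
Proof.
move=> [SL Sc] fle; split=> [x [Sx _]|x y z [Sx fx] [Sz fz] Ly xy yz]; first exact: SL.
have Sy : S y by apply: (Sc x y z).
by split=> //; have := fle _ _ Sx Sy xy; have := fle _ _ Sy Sz yz; lia.
Qed.

Lemma convexL : convex_in L.
Proof. by split. Qed.

(* [h i e] is a point of colour [e] in a piece of type [d], moving up with the time [i]; only for
   [d = C0] must a zero be reused. *)
Definition slots d (S : T -> Prop) n (h : nat -> color -> T) : Prop :=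
  [/\ forall i e, i < n -> chi_sub (csingle e) d -> S (h i e) /\ kappa (h i e) = e,
      forall i j e e', i < j -> j < n -> chi_sub (csingle e) d -> chi_sub (csingle e') d ->
        h i e = h j e' \/ lt (h i e) (h j e')
    & d <> C0 -> forall i j, i < j -> j < n -> chi_sub C0 d -> h i Zero <> h j Zero].

(** A constant point serves a single colour and an increasing chain serves [Cinf0]. In an
    alternating chain, time [i] owns the elements [2 * i] and [2 * i + 1], one of each colour. *)
Lemma has_type_slots d S n : convex_in S -> has_type lt kappa d S ->
  exists h, slots d S n h.
Proof.
move=> Sc; have single e : type_single kappa e S -> d = csingle e -> exists h, slots d S n h.
  move=> [[x Sx] [Se _]] ->; exists (fun _ _ => x); split.
  - by move=> i e' _ ee'; split=> //; rewrite (Se x Sx); case: e e' ee' {Se} => -[].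
  - by left.
  - by case: e {Se}.
have pair e1 e2 : e1 <> e2 -> type_inf2 lt kappa e1 e2 S -> d <> C0 ->
  (forall e, chi_sub (csingle e) d -> e = e1 \/ e = e2) -> exists h, slots d S n h.
  move=> ne [_ [_ [_ H]]] _ de; have [a [Sa [alt ak]]] := H n.
  pose b e : nat := if excluded_middle_informative (e = e2) then 1 else 0.
  have b1 e : b e <= 1 by rewrite /b; case: excluded_middle_informative.
  have La k : k < 2 * n.+1 -> L (a k) by move=> /Sa; apply: Sc.1.
  have lth i j e e' : i < j -> j < n -> lt (a (2 * i + b e)) (a (2 * j + b e')).
    move=> ij jn; have := b1 e; have := b1 e'; move=> ? ?.
    by apply: (chain_lt La alt); lia.
  exists (fun i e => a (2 * i + b e)); split.
  - move=> i e ilt /de ee; have ? := b1 e; split; first by apply: Sa; lia.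
    rewrite ak; last by lia.
    rewrite oddD oddM /= /b; case: excluded_middle_informative => //=.
    by case: ee.
  - by move=> *; right; apply: lth.
  - move=> _ i j ij jn _ eij; have := lth i j Zero Zero ij jn; rewrite eij.
    by apply: (lt_irr co); apply: La; have := b1 Zero; lia.
case: d single pair => single pair /= H.
- exact: (single Plus).
- exact: (single Minus).
- exact: (single Zero).
- have [a [Sa alt]] := inf0_chain n Sc H; have La i : i < n -> L (a i) by move=> /Sa /Sc.1.
  exists (fun i _ => a i); split=> [i e ilt|i j e e' ij jn _ _|_ i j ij jn _ eij].
  + by case: e => // _; split; [apply: Sa|apply: H.2; apply: Sa].
  + by right; apply: (chain_lt La alt).
  + by have := chain_lt La alt ij jn; rewrite eij; apply: (lt_irr co); apply: La.
- by apply: (pair Plus Minus) => //; case=> //; [left|right].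
- by apply: (pair Plus Zero) => //; case=> //; [left|right].
- by apply: (pair Minus Zero) => //; case=> //; [left|right].
Qed.

(** The rank of a point is the number of indices whose entry lies below it. It serves as the time at
    which the point is placed. *)
Lemma rank_exists n (a : nat -> T) : (forall i, i < n -> L (a i)) ->
  exists rk : T -> nat, (forall i, i < n -> rk (a i) < n)
   /\ (forall i j, i < n -> j < n -> lt (a i) (a j) -> rk (a i) < rk (a j)).
Proof.
move=> La; pose b x i : bool := if excluded_middle_informative (lt (a i) x) then true else false.
have bP x i : b x i <-> lt (a i) x by rewrite /b; case: excluded_middle_informative.
exists (fun x => #|[set i : 'I_n | b x i]|); split.
- move=> i ilt; rewrite -[ltnRHS](card_ord n) -cardsT; apply: proper_card.
  apply/properP; split; first exact: subsetT.
  exists (Ordinal ilt); rewrite ?inE //=; apply/negP => /bP.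
  by apply: (lt_irr co); apply: La.
- move=> i j ilt jlt ij; apply: proper_card; apply/properP; split.
    apply/subsetP => k; rewrite !inE => /bP ki; apply/bP.
    by apply: (lt_tr co _ (La i ilt) _ ki ij); apply: La.
  exists (Ordinal ilt); rewrite ?inE /=; first exact/bP.
  by apply/negP => /bP; apply: (lt_irr co); apply: La.
Qed.

Lemma decomposition_indexed Ls cs : decomposition L lt kappa Ls cs ->
  exists f, indexed lt kappa L (size cs) f (nth Cp cs).
Proof.
move=> [sz [cov [subL [disj [mono [_ types]]]]]]; rewrite -sz.
have [f fP] := choice_fun_in 0 cov.
have pieceE k : k < size Ls -> nth (fun _ => False) Ls k = (fun x => L x /\ f x = k).
  move=> ksz; apply: pred_ext => x; split=> [Lkx|[Lx <-]]; last by case: (fP x Lx).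
  have Lx := subL _ _ ksz Lkx; split=> //; have [fsz Lfx] := fP x Lx.
  by case: (eqVneq (f x) k) => // /eqP ne; case: (disj _ _ _ fsz ksz ne Lfx Lkx).
exists f; split.
- by move=> x /fP [].
- move=> x y Lx Ly xy; rewrite leqNgt; apply/negP => yx.
  have [fx ?] := fP x Lx; have [fy ?] := fP y Ly.
  by apply: (lt_asym Lx Ly xy); apply: (mono (f y) (f x)).
- by move=> k ksz; rewrite -pieceE //; apply: types.
Qed.

Lemma indexed_decomposition n f c : indexed lt kappa L n f c ->
  decomposition L lt kappa (mkseq (fun k x => L x /\ f x = k) n) (mkseq c n).
Proof.
move=> [fn fle types]; rewrite /decomposition !size_mkseq.
have pieceE k : k < n -> nth (fun _ => False) (mkseq (fun k x => L x /\ f x = k) n) k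
    = (fun x => L x /\ f x = k) by move=> kn; rewrite nth_mkseq.
split=> //; split; [|split; [|split; [|split; [|split]]]].
- by move=> x Lx; exists (f x); rewrite pieceE ?fn.
- by move=> i x ilt; rewrite pieceE // => -[].
- by move=> i j x ilt jlt ne; rewrite !pieceE // => -[_ ei] [_ ej]; apply: ne; rewrite -ei.
- move=> i j x y ij jlt; rewrite !pieceE //; last exact: ltn_trans jlt.
  move=> [Lx fx] [Ly fy]; case: (lt_total co Lx Ly) => [exy|[//|yx]].
    by move: ij; rewrite -fx -fy exy ltnn.
  by have := fle _ _ Ly Lx yx; lia.
- move=> i x y z ilt; rewrite !pieceE // => -[Lx fx] [Lz fz] Ly xy yz; split=> //.
  by have := fle _ _ Lx Ly xy; have := fle _ _ Ly Lz yz; lia.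
- by move=> i ilt; rewrite pieceE // nth_mkseq //; apply: types.
Qed.

End ColoredOrders.

(** * Finite homomorphisms and chi-homomorphisms *)

Lemma chi_sub_single_block c d : chi_sub c d -> d = C0 -> c = C0.
Proof. by case: c; case: d. Qed.

Section Homomorphisms.
Variables (T T' : Type) (L : T -> Prop) (lt : T -> T -> Prop) (kappa : T -> color).
Variables (L' : T' -> Prop) (lt' : T' -> T' -> Prop) (kappa' : T' -> color).
Hypothesis co : colored_order L lt kappa.
Hypothesis co' : colored_order L' lt' kappa'.

Definition color_code (e : color) : nat := match e with Plus => 0 | Minus => 1 | Zero => 2 end.

(** An element of rank [r] goes to the [r]-th period of a long [cyc3] chain, at the letter of its
    own colour. Different ranks use different periods, so the map is even strictly increasing. *)
Lemma inf3_fin_hom : type_inf3 lt' kappa' L' -> fin_hom L lt kappa L' lt' kappa'.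
Proof.
move=> H n a La; have [b [Lb [blt bk]]] := H n.
have [rk [rkn rklt]] := rank_exists co La.
have code2 e : color_code e <= 2 by case: e.
have key i : i < n -> 3 * rk (a i) + color_code (kappa (a i)) < 3 * n.+1.
  by move=> /rkn; have := code2 (kappa (a i)); lia.
exists (fun x => b (3 * rk x + color_code (kappa x))); split=> [i ilt|i j ilt jlt ij].
  split; first by apply/Lb/key.
  rewrite bk; last exact: key.
  by rewrite /cyc3 mulnC modnMDl; case: (kappa (a i)).
have lij : lt' (b (3 * rk (a i) + color_code (kappa (a i))))
               (b (3 * rk (a j) + color_code (kappa (a j)))).
  apply: (chain_lt co' Lb blt); last exact: key.
  by have := rklt i j ilt jlt ij; have := code2 (kappa (a i)); lia.
split=> [|_ _ e]; first by right.
by move: lij; rewrite e; apply: (lt_irr co'); apply/Lb/key.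
Qed.

(** Consecutive elements of a [cyc3] chain differ in colour, so their images differ and weak
    monotonicity becomes strict. *)
Lemma fin_hom_inf3 : fin_hom L lt kappa L' lt' kappa' ->
  type_inf3 lt kappa L -> type_inf3 lt' kappa' L'.
Proof.
move=> hom H n; have [a [La [alt ak]]] := H n.
have [phi [phiP phile]] := hom _ _ La.
exists (phi \o a) => /=; split; [|split].
- by move=> i /phiP [].
- move=> i ilt; have ilt' := ltnW ilt; have [[e|//] _] := phile i i.+1 ilt' ilt (alt i ilt).
  have [_ k1] := phiP i ilt'; have [_ k2] := phiP i.+1 ilt.
  move: k1 k2; rewrite e !ak // => -> {e}; rewrite /cyc3 -(addn1 i) -modnDml.
  by have := ltn_pmod i (isT : 0 < 3); case: (i %% 3)%N => [|[|[|]]].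
- by move=> i ilt; have [_ ->] := phiP i ilt; apply: ak.
Qed.

(** The piece of an element is moved by [psi], and inside the target piece the element takes the
    slot given by its rank and colour. Injectivity on zeros is where canonicity of the source
    enters. *)
Lemma chi_hom_fin_hom (t0 : T') Ls cs Ls' ds :
  decomposition L lt kappa Ls cs -> canonical cs ->
  decomposition L' lt' kappa' Ls' ds -> chi_hom cs ds -> fin_hom L lt kappa L' lt' kappa'.
Proof.
move=> /(decomposition_indexed co) [f [fn fle ft]] can.
move=> /(decomposition_indexed co') [f' [fn' fle' ft']] [psi [psin [psile psisub]]] n a La.
have [rk [rkn rklt]] := rank_exists co La.
have [h hP] := choice_fun_in (fun _ _ => t0) (P := fun k => k < size ds)
  (R := fun k h => _) (fun k kn => has_type_slots co' n
     (level_convex k (convexL L' lt') fle') (ft' k kn)).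
have psik x : L x -> psi (f x) < size ds by move=> /fn /psin.
have sub x : L x -> chi_sub (csingle (kappa x)) (nth Cp ds (psi (f x))).
  move=> Lx; apply: chi_sub_trans (psisub _ (fn x Lx)).
  exact: has_type_color (ft _ (fn x Lx)) (conj Lx erefl).
pose b x := h (psi (f x)) (rk x) (kappa x).
have bP i : i < n -> (L' (b (a i)) /\ f' (b (a i)) = psi (f (a i))) /\ kappa' (b (a i)) = kappa (a i).
  move=> ilt; have Li := La i ilt; have [slot _ _] := hP _ (psik _ Li).
  by apply: slot; [apply: rkn|apply: sub].
exists b; split=> [i /bP [[? _] ?]//|i j ilt jlt ij].
have [Li Lj] := (La i ilt, La j jlt); have [[L'i fi] _] := bP i ilt; have [[L'j fj] _] := bP j jlt.
have fij := fle _ _ Li Lj ij; have psij := psile _ _ fij (fn _ Lj).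
have rij := rklt i j ilt jlt ij; have rj := rkn j jlt.
split.
  case: (lt_total co' L'i L'j) => [|[|ji]]; [by left|by right|].
  have epsi : psi (f (a i)) = psi (f (a j)).
    by have := fle' _ _ L'j L'i ji; rewrite fi fj; lia.
  have [_ slotle _] := hP _ (psik _ Lj); rewrite /b epsi; apply: slotle => //; last exact: sub.
  by rewrite -epsi; apply: sub.
move=> ki kj eb.
have epsi : psi (f (a i)) = psi (f (a j)) by rewrite -fi -fj eb.
have [_ _ slotne] := hP _ (psik _ Lj).
have subj := sub _ Lj; rewrite kj in subj.
(* Zeros of different ranks share a slot only in a piece that is a lone zero. *)
have dC0 : nth Cp ds (psi (f (a j))) = C0.
  apply: NNPP => dne; apply: (slotne dne _ _ rij rj subj).
  by move: eb; rewrite /b ki kj epsi.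
(* By monotonicity [psi] is constant on these indices, and only [C0] lies below [C0]. *)
have cC0 k : f (a i) <= k <= f (a j) -> nth Cp cs k = C0.
  move=> /andP[ik kj']; have klt := leq_ltn_trans kj' (fn _ Lj).
  have : psi k = psi (f (a j)).
    by have := psile _ _ ik klt; have := psile _ _ kj' (fn _ Lj); lia.
  by have := psisub _ klt; move=> /[swap] -> /chi_sub_single_block; apply.
(* In a common piece of type [C0] the two zeros coincide. Otherwise the piece of [a i] and its
   successor are neighbours of equal colour, against the first clause of [canonical]. *)
case: (leqP (f (a j)) (f (a i))) => [ji|ltij].
  have ef : f (a i) = f (a j) by lia.
  have := ft _ (fn _ Li); rewrite cC0; last by rewrite leqnn.
  move=> [_ [_ /(_ erefl) uniq0]]; apply: (lt_irr co Lj).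
  by rewrite -{1}(uniq0 (a i) (a j)).
have [] := can (f (a i)) (f (a i)).+1 (fn _ Li) (leq_ltn_trans ltij (fn _ Lj)).
rewrite !cC0; try by [lia|apply/andP; split; lia].
move=> /(_ _ isT) [|z [_]]; first by lia.
by rewrite /strictly_between; lia.
Qed.

(** Without a repetition the sequence increases strictly, so [t <= v t] throughout and [v m] reaches
    [m]. *)
Lemma weak_chain_repeats m (v : nat -> nat) : (forall t, t <= m -> v t < m) ->
  (forall t, t < m -> v t <= v t.+1) -> exists2 t, t < m & v t = v t.+1.
Proof.
move=> vm vle; apply: NNPP => H.
have vge t : t <= m -> t <= v t.
  elim: t => // t IHt tm; have := IHt (ltnW tm); have := vle t tm.
  have : v t <> v t.+1 by move=> e; apply: H; exists t.
  by lia.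
by have := vge m (leqnn m); have := vm m (leqnn m); lia.
Qed.

Lemma two_zeros_type d S x y : has_type lt' kappa' d S -> S x -> S y ->
  kappa' x = Zero -> kappa' y = Zero -> x <> y -> chi_sub Cinf0 d.
Proof.
move=> td Sx Sy kx ky nxy; have := has_type_color td Sx; rewrite kx.
by case: d td => // -[_ [_ /(_ erefl x y Sx Sy)]].
Qed.

Lemma two_colors_type d e1 e2 S x y : has_type lt' kappa' d S -> S x -> S y ->
  kappa' x = e1 -> kappa' y = e2 -> e1 <> e2 -> chi_sub (cpair e1 e2) d.
Proof.
move=> td Sx Sy kx ky; have := has_type_color td Sx; have := has_type_color td Sy.
by rewrite kx ky; case: d {td} => //; case: e1 {kx}; case: e2 {ky}.
Qed.

(** Each source piece supplies a block of [m.+1] elements typical of it. As the target has only [m]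
    pieces, two consecutive elements of an increasing block land in one piece, whose type must then
    contain the type of the source piece. A piece of a single colour needs only one element. *)
Lemma fin_hom_chi_hom (t0 : T) Ls cs Ls' ds :
  decomposition L lt kappa Ls cs -> decomposition L' lt' kappa' Ls' ds ->
  fin_hom L lt kappa L' lt' kappa' -> chi_hom cs ds.
Proof.
move=> /(decomposition_indexed co) [f [fn fle ft]].
move=> /(decomposition_indexed co') [f' [fn' fle' ft']] hom.
set m := size ds; set p := size cs.
have fconv k : convex_in L lt (fun x => L x /\ f x = k) by apply: level_convex fle.
have fin k : k < p -> exists e : nat -> T, (forall t, t <= m -> L (e t) /\ f (e t) = k)
  /\ match nth Cp cs k with
     | Cinf0 => forall t, t < m -> lt (e t) (e t.+1)
     | Cpm | Cp0 | Cm0 => (forall t, t < m -> lt (e t) (e t.+1)) /\ forall t, t < m ->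
         cpair (kappa (e t)) (kappa (e t.+1)) = nth Cp cs k /\ kappa (e t) <> kappa (e t.+1)
     | _ => True
     end.
  move=> kp; have := ft k kp.
  have single s : type_single kappa s (fun x => L x /\ f x = k) ->
    exists e : nat -> T, (forall t, t <= m -> L (e t) /\ f (e t) = k) /\ True.
    by case=> -[x Lx] _; exists (fun _ => x).
  have pair e1 e2 : e1 <> e2 -> type_inf2 lt kappa e1 e2 (fun x => L x /\ f x = k) ->
    exists e : nat -> T, (forall t, t <= m -> L (e t) /\ f (e t) = k) /\
      ((forall t, t < m -> lt (e t) (e t.+1)) /\ forall t, t < m ->
         cpair (kappa (e t)) (kappa (e t.+1)) = cpair e1 e2 /\ kappa (e t) <> kappa (e t.+1)).
    move=> ne [_ [_ [_ /(_ m) [a [La [alt ak]]]]]]; exists a; split=> [t tm|].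
      by apply: La; lia.
    split=> t tm; first by apply: alt; lia.
    rewrite !ak /=; try lia.
    by case: (odd t); split=> //; try exact: nesym; case: e1 e2 {ne ak} => -[].
  case: (nth Cp cs k) => //=; try exact: single.
  - move=> /(inf0_chain co m.+1 (fconv k)) [a [La alt]]; exists a; split=> [t|t]; first exact: La.
    exact: alt.
  - exact: pair.
  - exact: pair.
  - exact: pair.
have [e eP] := choice_fun_in (fun _ => t0) fin => {fin}.
(* The blocks are concatenated: the quotient of the position names the piece, the remainder the
   place inside its block. *)
pose a r := e (r %/ m.+1) (r %% m.+1).
have aE k t : t <= m -> a (k * m.+1 + t) = e k t.
  by move=> tm; rewrite /a divnMDl // modnMDl divn_small ?modn_small ?addn0.
have keylt k t : k < p -> t <= m -> k * m.+1 + t < p * m.+1.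
  by move=> kp tm; have := leq_mul kp (leqnn m.+1); rewrite mulSn; lia.
have La r : r < p * m.+1 -> L (a r).
  rewrite -ltn_divLR // => rp; have [eL _] := eP _ rp.
  by case: (eL (r %% m.+1)); rewrite // -ltnS ltn_pmod.
have [phi [phiP phile]] := hom _ a La.
have ephi k t : k < p -> t <= m -> L' (phi (e k t)) /\ kappa' (phi (e k t)) = kappa (e k t).
  by move=> kp tm; have := phiP _ (keylt k t kp tm); rewrite aE.
have ephile k t k' t' : k < p -> t <= m -> k' < p -> t' <= m -> lt (e k t) (e k' t') ->
    (phi (e k t) = phi (e k' t') \/ lt' (phi (e k t)) (phi (e k' t')))
    /\ (kappa (e k t) = Zero -> kappa (e k' t') = Zero -> phi (e k t) <> phi (e k' t')).
  move=> kp tm kp' tm'; have := phile _ _ (keylt k t kp tm) (keylt k' t' kp' tm').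
  by rewrite !aE.
(* The target index is one actually visited by block [k]; monotonicity of [psi] across blocks
   follows from this. *)
have target k : k < p -> exists j, (exists2 t, t <= m & f' (phi (e k t)) = j)
    /\ chi_sub (nth Cp cs k) (nth Cp ds j).
  move=> kp; have [eL et] := eP k kp; have tk := ft k kp.
  have pc t : t <= m -> has_type lt' kappa' (nth Cp ds (f' (phi (e k t))))
      (fun x => L' x /\ f' x = f' (phi (e k t))).
    by move=> /(ephi _ _ kp) [/fn' /ft'].
  have single s : nth Cp cs k = csingle s -> chi_sub (nth Cp cs k) (nth Cp ds (f' (phi (e k 0)))).
    move=> cE; rewrite [X in chi_sub X]cE; have [L'e <-] : L' (phi (e k 0)) /\ kappa' (phi (e k 0)) = s.
      have [L'e ->] := ephi k 0 kp isT; split=> //.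
      have := has_type_color tk (eL 0 isT); rewrite cE.
      by case: (kappa _); case: s {cE}.
    by apply: (has_type_color (pc 0 isT)).
  (* The last clause serves [Cinf0]: two consecutive zeros in one target piece still have distinct
     images, so that piece is not a lone zero. *)
  have rep : (forall t, t < m -> lt (e k t) (e k t.+1)) -> exists t,
      [/\ t < m, f' (phi (e k t)) = f' (phi (e k t.+1)) & phi (e k t) <> phi (e k t.+1) \/
        kappa (e k t) <> Zero \/ kappa (e k t.+1) <> Zero].
    move=> ltchain; have [t tm rep] : exists2 t, t < m & f' (phi (e k t)) = f' (phi (e k t.+1)).
      apply: (weak_chain_repeats (v := fun t => f' (phi (e k t)))) => t tm.
        by apply: fn'; case: (ephi k t kp tm).
      have [L1 _] := ephi k t kp (ltnW tm); have [L2 _] := ephi k t.+1 kp tm.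
      have [[->//|llt] _] := ephile k t k t.+1 kp (ltnW tm) kp tm (ltchain t tm).
      exact: (fle' _ _ L1 L2 llt).
    exists t; split=> //; have [_ zne] := ephile k t k t.+1 kp (ltnW tm) kp tm (ltchain t tm).
    by case: (classic (kappa (e k t) = Zero)) => [/zne|]; tauto.
  have pair : (forall t, t < m -> lt (e k t) (e k t.+1)) /\ (forall t, t < m ->
      cpair (kappa (e k t)) (kappa (e k t.+1)) = nth Cp cs k /\ kappa (e k t) <> kappa (e k t.+1)) ->
    exists j, (exists2 t, t <= m & f' (phi (e k t)) = j) /\ chi_sub (nth Cp cs k) (nth Cp ds j).
    move=> [/rep [t [tm et' _]] /(_ t tm) [<- ne]].
    exists (f' (phi (e k t))); split; first by exists t => //; apply: ltnW.
    have [L1 k1] := ephi k t kp (ltnW tm); have [L2 k2] := ephi k t.+1 kp tm.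
    exact: (two_colors_type (pc t (ltnW tm)) (conj L1 erefl) (conj L2 (esym et')) k1 k2).
  have {}single s : nth Cp cs k = csingle s ->
    exists j, (exists2 t, t <= m & f' (phi (e k t)) = j) /\ chi_sub (nth Cp cs k) (nth Cp ds j).
    by move=> /single sub0; exists (f' (phi (e k 0))); split=> //; exists 0.
  move: et; case cE: (nth Cp cs k) pair single => pair single et; try exact: pair.
  - exact: (single Plus).
  - exact: (single Minus).
  - exact: (single Zero).
  have [t [tm et' ne]] := rep et; exists (f' (phi (e k t))).
  split; first by exists t => //; apply: ltnW.
  have [L1 k1] := ephi k t kp (ltnW tm); have [L2 k2] := ephi k t.+1 kp tm.
  have k0 t' : t' <= m -> kappa (e k t') = Zero.
    by move=> tm'; move: tk; rewrite cE => -[_]; apply; apply: eL.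
  rewrite !k0 in k1 k2 ne => //; try exact: ltnW.
  apply: (two_zeros_type (pc t (ltnW tm)) (conj L1 erefl) (conj L2 (esym et')) k1 k2).
  by case: ne => [//|[]].
have [psi psiP] := choice_fun_in 0 target.
exists psi; split; [|split].
- by move=> k kp; have [[t tm <-] _] := psiP k kp; apply: fn'; case: (ephi k t kp tm).
- move=> i j; rewrite leq_eqVlt => /orP[/eqP->//|ij] jp; have ip := ltn_trans ij jp.
  have [[t tm <-] _] := psiP i ip; have [[t' tm' <-] _] := psiP j jp.
  have [[Li fi] [Lj fj]] := ((eP i ip).1 t tm, (eP j jp).1 t' tm').
  have lij : lt (e i t) (e j t').
    case: (lt_total co Li Lj) => [E|[//|/(fle _ _ Lj Li)]]; last by rewrite fi fj; lia.
    by move: ij; rewrite -fi -fj E ltnn.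
  have [L1 _] := ephi i t ip tm; have [L2 _] := ephi j t' jp tm'.
  by have [[->//|llt] _] := ephile i t j t' ip tm jp tm' lij; apply: (fle' _ _ L1 L2 llt).
- by move=> k /psiP [].
Qed.
End Homomorphisms.
(** * Existence of canonical decompositions *)

Section CanonicalDecomposition.
Variables (T : Type) (L : T -> Prop) (lt : T -> T -> Prop) (kappa : T -> color).
Hypothesis co : colored_order L lt kappa.

Definition indexable (S : T -> Prop) : Prop := exists n f c, indexed lt kappa S n f c.

Lemma has_type_inhabited c S : has_type lt kappa c S -> exists x, S x.
Proof.
by case: c => /=; try by [case]; try by [case=> _ [[x []]]; exists x];
  case=> /(_ 1) [a [Sa _]] _; exists (a 0); apply: Sa.
Qed.

Lemma indexable_empty S : (forall x, ~ S x) -> indexable S.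
Proof. by move=> S0; exists 0, (fun _ => 0), (fun _ => Cp); split=> [x /S0|x y /S0|]. Qed.

Lemma indexable_type c S : has_type lt kappa c S -> indexable S.
Proof.
move=> Sc; exists 1, (fun _ => 0), (fun _ => c); split=> // -[|//] _.
by rewrite (_ : (fun x => _) = S) //; apply: pred_ext => x; split=> [[]|].
Qed.

Lemma indexable_cat S S1 S2 : (forall x, S x <-> S1 x \/ S2 x) -> (forall x, S x -> L x) ->
  (forall x y, S1 x -> S2 y -> lt x y) -> indexable S1 -> indexable S2 -> indexable S.
Proof.
move=> SE SL S12 [n1 [f1 [c1 [fn1 fle1 ft1]]]] [n2 [f2 [c2 [fn2 fle2 ft2]]]].
have S1L x : S1 x -> L x by move=> ?; apply/SL/SE; left.
have S2L x : S2 x -> L x by move=> ?; apply/SL/SE; right.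
pose f x := if excluded_middle_informative (S1 x) then f1 x else n1 + f2 x.
have fE1 x : S1 x -> f x = f1 x by rewrite /f; case: excluded_middle_informative.
have fE2 x : S2 x -> f x = n1 + f2 x.
  rewrite /f; case: excluded_middle_informative => // x1 x2.
  by case: (lt_irr co (S1L x x1)); apply: S12.
exists (n1 + n2), f, (fun k => if k < n1 then c1 k else c2 (k - n1)); split.
- move=> x /SE [Sx|Sx]; first by rewrite fE1 //; have := fn1 x Sx; lia.
  by rewrite fE2 //; have := fn2 x Sx; lia.
- move=> x y /SE [Sx|Sx] /SE [Sy|Sy] xy.
  + by rewrite !fE1 //; apply: fle1.
  + by rewrite fE1 // fE2 //; have := fn1 x Sx; lia.
  + by case: (lt_asym co (S1L _ Sy) (S2L _ Sx)) => //; apply: S12.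
  + by rewrite !fE2 // leq_add2l; apply: fle2.
- move=> k kn; case: ltnP => kn1.
    rewrite (_ : (fun x => _) = (fun x => S1 x /\ f1 x = k)); first exact: ft1.
    apply: pred_ext => x; split=> [[/SE [Sx|Sx]]|[Sx fx]].
    + by rewrite fE1.
    + by rewrite fE2 //; lia.
    + by split; [apply/SE; left|rewrite fE1].
  rewrite (_ : (fun x => _) = (fun x => S2 x /\ f2 x = k - n1)); first by apply: ft2; lia.
  apply: pred_ext => x; split=> [[/SE [Sx|Sx]]|[Sx fx]].
  + by rewrite fE1 // => e; have := fn1 x Sx; lia.
  + by rewrite fE2 // => e; split=> //; lia.
  + by split; [apply/SE; right|rewrite fE2 //; lia].
Qed.

(** Decompositions of the levels are concatenated, splitting off the top level at each step of the
    induction. *)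
Lemma indexable_levels N (f : T -> nat) S : (forall x, S x -> L x) ->
  (forall x, S x -> f x < N) -> (forall x y, S x -> S y -> lt x y -> f x <= f y) ->
  (forall k, k < N -> indexable (fun x => S x /\ f x = k)) -> indexable S.
Proof.
elim: N S => [|N IHN] S SL fN fle lev.
  by apply: indexable_empty => x /fN.
apply: (@indexable_cat S (fun x => S x /\ f x < N) (fun x => S x /\ f x = N)) => //.
- move=> x; split=> [Sx|[[]|[]] //]; have := fN x Sx; rewrite ltnS leq_eqVlt.
  by case/orP => [/eqP|] ?; [right|left].
- move=> x y [Sx fx] [Sy fy]; case: (lt_total co (SL _ Sx) (SL _ Sy)) => [e|[//|/(fle _ _ Sy Sx)]].
    by move: fx; rewrite e fy ltnn.
  by lia.
- apply: IHN => [x []|x []|x y [? _] [? _]|k kN]; [by move=> /SL|by []|exact: fle|].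
  rewrite (_ : (fun x => _) = (fun x => S x /\ f x = k)); first by apply: lev; lia.
  apply: pred_ext => x; split=> [[[]]|[Sx fx]] //; by rewrite fx.
- exact: lev.
Qed.

(* The first [k] letters of [u] can be read off increasingly from [S] up to [x]. The witnesses may
   weakly increase because consecutive letters of the words [u] used are distinct. *)
Fixpoint reaches (S : T -> Prop) (u : nat -> color) (k : nat) (x : T) : Prop :=
  if k is k'.+1 then
    exists y, [/\ S y, y = x \/ lt y x, kappa y = u k' & reaches S u k' y]
  else True.

Lemma reaches_mono (S : T -> Prop) u k x y : (forall x, S x -> L x) -> L x -> L y -> lt x y ->
  reaches S u k x -> reaches S u k y.
Proof.
move=> SL Lx Ly xy; case: k => //= k [z [Sz zx kz rz]]; exists z; split=> //.
right; case: zx => [->//|zx]; exact: (lt_tr co (SL _ Sz) Lx Ly zx xy).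
Qed.

Lemma reaches_pred (S : T -> Prop) u k x : (forall x, S x -> L x) -> L x ->
  reaches S u k.+1 x -> reaches S u k x.
Proof.
by move=> SL Lx /= [y [Sy [<-//|yx] _ ry]]; apply: (reaches_mono SL (SL _ Sy) Lx yx).
Qed.

Lemma reaches_down (S : T -> Prop) u k l x : (forall x, S x -> L x) -> L x -> l <= k ->
  reaches S u k x -> reaches S u l x.
Proof.
move=> SL Lx; elim: k => [|k IHk]; first by rewrite leqn0 => /eqP->.
by rewrite leq_eqVlt => /orP[/eqP->//|lk] /(reaches_pred SL Lx); apply: IHk.
Qed.

(** Consecutive letters differ, so weakly increasing witnesses increase strictly. The middle
    disjunction serves the induction: only the last witness must be compared with [x]. *)
Lemma reaches_chain (S : T -> Prop) u k x : (forall k, u k <> u k.+1) -> reaches S u k x ->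
  exists a : nat -> T, (forall i, i < k ->
      [/\ S (a i), a i = x \/ i.+1 < k \/ lt (a i) x & kappa (a i) = u i])
    /\ (forall i, i.+1 < k -> lt (a i) (a i.+1)).
Proof.
move=> une; elim: k x => [|k IHk] x; first by exists (fun _ => x).
move=> /= [y [Sy yx ky /IHk [a [aP alt]]]].
exists (fun i => if i < k then a i else y); split=> i ik.
  case: ltnP => ik'; first by have [Sa _ ka] := aP i ik'; split=> //; right; left.
  by have -> : i = k by [lia]; split=> //; tauto.
have ik' : i < k by lia.
rewrite ik'; case: ltnP => [|ki]; first exact: alt.
have [_ ay ka] := aP i ik'; have ek : k = i.+1 by lia.
case: ay => [e|[|//]]; last by lia.
by case: (une i); rewrite -ka e ky ek.
Qed.

(* Cut [S] according to how much of [u] has been read: no element of level [k] has colour [u k]. *)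
Lemma bounded_reach_indexable S u M : convex_in L lt S ->
  (forall x, S x -> ~ reaches S u M x) ->
  (forall k S', convex_in L lt S' -> (forall x, S' x -> kappa x <> u k) ->
     (forall x, S' x -> S x) -> indexable S') ->
  indexable S.
Proof.
move=> Sc bound miss; have SL := Sc.1.
(* The level of [x] is a length at which reading gets stuck. One exists below [M], since otherwise
   all [M] letters could be read. *)
have [f fP] : exists f : T -> nat, forall x, S x ->
    [/\ f x < M, reaches S u (f x) x & ~ reaches S u (f x).+1 x].
  apply: (choice_fun_in 0 (P := S)
    (R := fun x k => [/\ k < M, reaches S u k x & ~ reaches S u k.+1 x])) => x Sx; apply: NNPP => H.
  have all k : k <= M -> reaches S u k x.
    elim: k => // k IHk kM; apply: NNPP => nr; apply: H; exists k; split=> //.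
    by apply: IHk; apply: ltnW.
  exact: (bound x Sx (all M (leqnn M))).
have fle x y : S x -> S y -> lt x y -> f x <= f y.
  move=> Sx Sy xy; rewrite leqNgt; apply/negP => lef.
  have [_ rx _] := fP x Sx; have [_ _] := fP y Sy; apply.
  apply: (reaches_down SL (SL _ Sy) lef).
  exact: (reaches_mono SL (SL _ Sx) (SL _ Sy) xy).
apply: (indexable_levels (N := M) (f := f)) => // [x /fP []//|k kM].
apply: (miss k) => [|x [Sx fx] kx|x []//]; first exact: level_convex.
(* An element of level [k] with colour [u k] would itself serve as the next letter. *)
have [_ rx] := fP x Sx; apply; exists x; split=> //; first by left.
by rewrite fx.
Qed.

Lemma mono_indexable e S : convex_in L lt S -> (forall x, S x -> kappa x = e) -> indexable S.
Proof.
move=> Sc Se; case: (classic (exists x, S x)) => [[x Sx]|ne]; last first.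
  by apply: indexable_empty => x Sx; apply: ne; exists x.
case: e Se => Se.
- by apply: (@indexable_type Cp); split; [exists x|split].
- by apply: (@indexable_type Cm); split; [exists x|split].
case: (classic (exists y, S y /\ x <> y)) => [[y [Sy nxy]]|sing].
  exact/(@indexable_type Cinf0)/(mono_inf0 co Sc Se Sx Sy).
have eqx y : S y -> x = y by move=> Sy; apply: NNPP => nxy; apply: sing; exists y.
apply: (@indexable_type C0); split; [by exists x|split=> // _ y z Sy Sz].
by rewrite -(eqx y) // -(eqx z).
Qed.

(** If alternating words can be read only up to a bounded length, the levels are monochromatic;
    otherwise the whole set has the pair type, which [d] names. *)
Lemma two_colors_indexable d e1 e2 S : e1 <> e2 -> convex_in L lt S ->
  (forall x, S x -> kappa x = e1 \/ kappa x = e2) ->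
  (type_inf2 lt kappa e1 e2 S -> has_type lt kappa d S) -> indexable S.
Proof.
move=> ne Sc Se td; pose u i := if odd i then e2 else e1.
have une i : u i <> u i.+1 by rewrite /u /=; case: (odd i) => //=; apply: nesym.
have [[M bound]|unbound] := classic (exists M, forall x, S x -> ~ reaches S u M x).
  apply: (bounded_reach_indexable Sc bound) => k S' Sc' miss SS'.
  (* Level [k] misses [u k], and [u k.+1] is the other of the two colours. *)
  apply: (mono_indexable (e := u k.+1)) => // x Sx; have := miss x Sx.
  by rewrite /u /=; case: (Se x (SS' x Sx)) => ->; case: (odd k).
apply/(@indexable_type d)/td.
have H n : exists a : nat -> T, (forall i, i < 2 * n.+1 -> S (a i))
    /\ (forall i, i.+1 < 2 * n.+1 -> lt (a i) (a i.+1))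
    /\ (forall i, i < 2 * n.+1 -> kappa (a i) = if odd i then e2 else e1).
  have [x [Sx rx]] : exists x, S x /\ reaches S u (2 * n.+1) x.
    apply: NNPP => nx; apply: unbound; exists (2 * n.+1) => x Sx rx.
    by apply: nx; exists x.
  have [a [aP alt]] := reaches_chain une rx.
  by exists a; split=> [i /aP []|]; [|split=> // i /aP []].
have [a [Sa [_ ka]]] := H 0.
by split=> //; split; [|split=> //]; [exists (a 0)|exists (a 1)]; rewrite ka //; split=> //; apply: Sa.
Qed.

Lemma cyc3_next i : cyc3 i <> cyc3 i.+1.
Proof.
rewrite /cyc3 -(addn1 i) -modnDml; have := ltn_pmod i (isT : 0 < 3).
by case: (i %% 3)%N => [|[|[|]]].
Qed.

(** The word [cyc3] can be read only up to a bounded length, and each level misses one colour, which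
    leaves sets of two colours. *)
Lemma indexable_not_inf3 : ~ type_inf3 lt kappa L -> indexable L.
Proof.
move=> ninf; have [n nP] : exists n, ~ exists a : nat -> T,
    (forall i, i < 3 * n.+1 -> L (a i))
    /\ (forall i, i.+1 < 3 * n.+1 -> lt (a i) (a i.+1))
    /\ (forall i, i < 3 * n.+1 -> kappa (a i) = cyc3 i).
  by apply: NNPP => H; apply: ninf => n; apply: NNPP => nP; apply: H; exists n.
apply: (bounded_reach_indexable (u := cyc3) (M := 3 * n.+1)) => //.
  move=> x Lx /(reaches_chain cyc3_next) [a [aP alt]]; apply: nP.
  by exists a; split=> [i /aP []|]; [|split=> // i /aP []].
move=> k S Sc miss _; case: (cyc3 k) miss => miss.
- apply: (@two_colors_indexable Cm0 Minus Zero) => // x /miss.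
  by case: (kappa x); tauto.
- apply: (@two_colors_indexable Cp0 Plus Zero) => // x /miss.
  by case: (kappa x); tauto.
- apply: (@two_colors_indexable Cpm Plus Minus) => // x /miss.
  by case: (kappa x); tauto.
Qed.

(** A piece whose type is contained in that of its neighbour brings no new colour, and the chains or
    infinite families required by the larger type are already present. *)
Lemma has_type_absorb c d S1 S2 : chi_sub c d ->
  convex_in L lt (fun x => S1 x \/ S2 x) -> (forall x y, S1 x -> S2 y -> x <> y) ->
  has_type lt kappa c S1 -> has_type lt kappa d S2 ->
  has_type lt kappa d (fun x => S1 x \/ S2 x).
Proof.
move=> cd Sc disj t1 t2.
have col x : S1 x \/ S2 x -> chi_sub (csingle (kappa x)) d.
  case=> Sx; last exact: has_type_color t2 Sx.
  exact: chi_sub_trans (has_type_color t1 Sx) cd.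
have [x1 Sx1] := has_type_inhabited t1; have [x2 Sx2] := has_type_inhabited t2.
have sup2 e1 e2 : type_inf2 lt kappa e1 e2 S2 ->
    (forall x, S1 x \/ S2 x -> kappa x = e1 \/ kappa x = e2) ->
    type_inf2 lt kappa e1 e2 (fun x => S1 x \/ S2 x).
  move=> [_ [[y [Sy ky]] [[z [Sz kz]] H]]] ke; split=> //; split; last split.
  - by exists y; split=> //; right.
  - by exists z; split=> //; right.
  - by move=> n; have [a [Sa aP]] := H n; exists a; split=> // i /Sa; right.
case: d cd t2 col => cd t2 col; rewrite /=.
- split; first by exists x2; right.
  by split=> // x /col; case: (kappa x).
- split; first by exists x2; right.
  by split=> // x /col; case: (kappa x).
(* Two adjacent lone zeros cannot occur: by [zero_gap] their union would be infinite, while three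
   distinct elements do not fit into two singletons. *)
- have k0 x : S1 x \/ S2 x -> kappa x = Zero by move=> /col; case: (kappa x).
  have [] : type_inf0 kappa (fun x => S1 x \/ S2 x).
    by apply: (mono_inf0 co Sc k0 (or_introl Sx1) (or_intror Sx2)); apply: disj.
  move=> /(_ 3) [a [Sa inja]] _; exfalso.
  have c0 : c = C0 by case: (c) cd.
  move: t1 t2; rewrite c0 => -[_ [_ /(_ erefl) u1]] [_ [_ /(_ erefl) u2]].
  have [[s0 s1] s2] := ((Sa 0 isT, Sa 1 isT), Sa 2 isT).
  have inj i j : i < 3 -> j < 3 -> i <> j -> a i <> a j by move=> i3 j3 ne /inja; auto.
  have n01 := inj 0 1 isT isT (fun e => ltac:(discriminate e)).
  have n02 := inj 0 2 isT isT (fun e => ltac:(discriminate e)).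
  have n12 := inj 1 2 isT isT (fun e => ltac:(discriminate e)).
  by case: s0 s1 s2 => [s0|s0] [s1|s1] [s2|s2];
    first [by apply: n01; auto|by apply: n02; auto|by apply: n12; auto].
- split; last by move=> x /col; case: (kappa x).
  by move=> n; have [a [Sa inja]] := t2.1 n; exists a; split=> // i /Sa; right.
- by apply: sup2 => // x /col; case: (kappa x); auto.
- by apply: sup2 => // x /col; case: (kappa x); auto.
- by apply: sup2 => // x /col; case: (kappa x); auto.
Qed.

(** The step that lowers the number of pieces as long as two neighbours have comparable types. *)
Lemma indexed_merge n f c i : indexed lt kappa L n.+1 f c -> i < n ->
  chi_sub (c i) (c i.+1) \/ chi_sub (c i.+1) (c i) ->
  exists f' c', indexed lt kappa L n f' c'.
Proof.
move=> [fn fle ft] ilt sub.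
have [d td] : exists d, has_type lt kappa d (fun x => L x /\ (f x = i \/ f x = i.+1)).
  have UE : (fun x => L x /\ (f x = i \/ f x = i.+1))
    = (fun x => (L x /\ f x = i) \/ (L x /\ f x = i.+1)) by apply: pred_ext => x; tauto.
  have UE' : (fun x => L x /\ (f x = i \/ f x = i.+1))
    = (fun x => (L x /\ f x = i.+1) \/ (L x /\ f x = i)) by apply: pred_ext => x; tauto.
  have Uc : convex_in L lt (fun x => L x /\ (f x = i \/ f x = i.+1)).
    split=> [x []//|x y z [Lx fx] [Lz fz] Ly xy yz]; split=> //.
    by have := fle _ _ Lx Ly xy; have := fle _ _ Ly Lz yz; lia.
  have t1 := ft i (leqW ilt); have t2 := ft i.+1 ilt.
  case: sub => sub; [exists (c i.+1)|exists (c i)].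
    rewrite UE in Uc *; apply: (has_type_absorb sub Uc _ t1 t2) => x y [_ fx] [_ fy] e.
    by move: fx; rewrite e fy; lia.
  rewrite UE' in Uc *; apply: (has_type_absorb sub Uc _ t2 t1) => x y [_ fx] [_ fy] e.
  by move: fx; rewrite e fy; lia.
(* Indices above [i] drop by one, so that pieces [i] and [i.+1] share the index [i]. *)
exists (fun x => if f x <= i then f x else (f x).-1).
exists (fun k => if k < i then c k else if k == i then d else c k.+1); split.
- by move=> x /fn; case: (leqP (f x) i); lia.
- by move=> x y Lx Ly /(fle _ _ Lx Ly); case: (leqP (f x) i); case: (leqP (f y) i); lia.
- move=> k kn; case: ltnP => ki.
    rewrite (_ : (fun x => _) = (fun x => L x /\ f x = k)); first by apply: ft; lia.
    by apply: pred_ext => x; case: (leqP (f x) i) => fi; split=> -[Lx fx]; split=> //; lia.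
  case: eqVneq => [->|nki].
    rewrite (_ : (fun x => _) = (fun x => L x /\ (f x = i \/ f x = i.+1))) //.
    by apply: pred_ext => x; case: (leqP (f x) i) => fi; split=> -[Lx fx]; split=> //; lia.
  rewrite (_ : (fun x => _) = (fun x => L x /\ f x = k.+1)); first by apply: ft; lia.
  by apply: pred_ext => x; case: (leqP (f x) i) => fi; split=> -[Lx fx]; split=> //; lia.
Qed.

End CanonicalDecomposition.

(** * Finite chi-coloured orderings with incomparable neighbours *)

Definition incomparable (c d : chi) : bool := ~~ chi_sub c d && ~~ chi_sub d c.

(* The second clause of [canonical] follows from the first: two distinct pairs together contain all
   three colours, so a lone element between them that is incomparable with both is the third pair. *)
Lemma adjacent_incomparable_canonical cs :
  (forall i, i.+1 < size cs -> incomparable (nth Cp cs i) (nth Cp cs i.+1)) -> canonical cs.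
Proof.
move=> adj c n; rewrite {}/n => x y xn yn.
have {}adj i : i.+1 < size cs -> incomparable (c i) (c i.+1) by apply: adj.
clearbody c; split.
  move=> nxy sub; have [xy|] := ltnP x.+1 y.
    by exists x.+1; rewrite /strictly_between; lia.
  have [yx|] := ltnP y.+1 x; first by exists y.+1; rewrite /strictly_between; lia.
  move=> le1 le2; exfalso; case: (ltngtP x y) => // [xy|yx].
    have ey : y = x.+1 by lia.
    by have := adj x; rewrite -ey => /(_ yn); rewrite /incomparable sub.
  have ex : x = y.+1 by lia.
  by have := adj y; rewrite -ex => /(_ xn); rewrite /incomparable sub andbF.
move=> [z0 [zn0 z0b]] px py nxy.
(* Clause (b) holds as soon as the third pair occurs strictly between [x] and [y]; otherwise all
   colours there are admissible for clause (a). *)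
pose other d := ~ List.In d [:: Cp; Cm; C0; Cinf0; c x; c y].
have third d : other d -> exists e e', [/\ e <> e', d = cpair e e',
    ~~ chi_sub (csingle e) (c x) & ~~ chi_sub (csingle e') (c y)].
  rewrite /other; case: (c x) px nxy; case: (c y) py => // _ _ nxy;
  case: d => //= no; first [ by case: no; auto 10
             | by exists Plus, Minus | by exists Plus, Zero | by exists Minus, Zero
             | by exists Minus, Plus | by exists Zero, Plus | by exists Zero, Minus ].
have [[z [zn zb /third [e [e' [ne ez nx ny]]]]]|none] :=
    classic (exists z, [/\ z < size cs, strictly_between z x y & other (c z)]).
  by right; exists z, e, e'.
left.
have std z : z < size cs -> strictly_between z x y -> List.In (c z) [:: Cp; Cm; C0; Cinf0; c x; c y].
  by move=> zn zb; apply: NNPP => no; apply: none; exists z.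
(* A lone element in between would be a neighbour of both pairs, yet every colour of the list is
   comparable with one of them. *)
have gap lo hi : lo.+1 < hi -> hi < size cs ->
    (c lo = c x /\ c hi = c y) \/ (c lo = c y /\ c hi = c x) ->
    (forall z, lo < z < hi -> List.In (c z) [:: Cp; Cm; C0; Cinf0; c x; c y]) ->
    lo.+2 < hi.
  move=> lohi hn cE inn; rewrite ltn_neqAle lohi andbT; apply/eqP => ehi.
  have a1 := adj lo (ltn_trans lohi hn); have := adj lo.+1; rewrite ehi => /(_ hn) a2.
  have := inn lo.+1; rewrite lohi leqnn => /(_ isT).
  move: a1 a2; case: cE => -[-> ->];
  by case: (c x) px nxy => // _; case: (c y) py => // _ _; case: (c lo.+1) => //= _ _; firstorder discriminate.
have dif i : i.+1 < size cs -> c i <> c i.+1.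
  by move=> /adj /[swap] e; rewrite e /incomparable chi_sub_refl.
case: (ltngtP x y) => [xy|yx|e]; last by rewrite e in nxy.
  have lt2 : x.+2 < y.
    apply: gap => //; [by move: z0b; rewrite /strictly_between; lia|by left|].
    by move=> z zb; apply: std; rewrite /strictly_between; lia.
  (* The first two elements after [x] are neighbours, hence incomparable and of different
     colours. *)
  exists x.+1, x.+2; split; first by lia.
  split; first by lia.
  split; first by left; lia.
  by split; [apply: dif|split; apply: std]; rewrite /strictly_between; lia.
have lt2 : y.+2 < x.
  apply: gap => //; [by move: z0b; rewrite /strictly_between; lia|by right|].
  by move=> z zb; apply: std; rewrite /strictly_between; lia.
exists y.+1, y.+2; split; first by lia.
split; first by lia.
split; first by right; lia.
by split; [apply: dif|split; apply: std]; rewrite /strictly_between; lia.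
Qed.

(** Merging comparable neighbours terminates because the number of pieces drops; what remains has
    incomparable neighbours. *)
Lemma canonical_decomposition_exists T (L : T -> Prop) lt kappa : colored_order L lt kappa ->
  ~ type_inf3 lt kappa L ->
  exists Ls cs, decomposition L lt kappa Ls cs /\ canonical cs.
Proof.
move=> co /(indexable_not_inf3 co) [n].
elim: n {-2}n (leqnn n) => [|N IHN] n nN [f [c fc]].
  exists (mkseq (fun k x => L x /\ f x = k) n), (mkseq c n).
  split; first exact: indexed_decomposition.
  by apply: adjacent_incomparable_canonical => i; rewrite size_mkseq; lia.
case: (classic (exists2 i, i.+1 < n & ~~ incomparable (c i) (c i.+1))) => [[i ilt ninc]|inc].
  case: n nN fc ilt => // n nN fc ilt.
  apply: (IHN n) => //; apply: (indexed_merge co fc ilt).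
  by move: ninc; rewrite /incomparable negb_and !negbK => /orP.
exists (mkseq (fun k x => L x /\ f x = k) n), (mkseq c n).
split; first exact: indexed_decomposition.
apply: adjacent_incomparable_canonical => i; rewrite size_mkseq => ilt.
rewrite !nth_mkseq //; last by lia.
by apply/negPn/negP => ninc; apply: inc; exists i.
Qed.
Import Order.TTheory GRing.Theory Num.Theory.
Local Open Scope ring_scope.

(** * Orbitals *)

Section AutQ.
Variable g : autQ.
Implicit Types x y z q : rat.

Lemma af_le x y : (g x <= g y) = (x <= y).
Proof. by apply: le_mono; apply: af_incr. Qed.

Lemma af_lt x y : (g x < g y) = (x < y).
Proof. by apply: leW_mono; apply: af_le. Qed.

Lemma ainv_le x y : (ainv g x <= ainv g y) = (x <= y).
Proof. by rewrite -af_le !ainv_K. Qed.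

Lemma ainv_lt x y : (ainv g x < ainv g y) = (x < y).
Proof. by rewrite -af_lt !ainv_K. Qed.

Lemma zitS n x : zit g (n + 1) x = g (zit g n x).
Proof.
case: n => [k|[|k]].
- by have -> : Posz k + 1 = Posz k.+1 by lia.
- by rewrite /= ainv_K.
- have -> : Negz k.+1 + 1 = Negz k by lia.
  by rewrite /= ainv_K.
Qed.

Lemma zitB n x : zit g (n - 1) x = ainv g (zit g n x).
Proof. by rewrite -{2}(subrK 1 n) zitS af_K. Qed.

(** Steps in both directions from an arbitrary integer match [zitS] and [zitB], which avoids
    splitting on signs. *)
Lemma int_step_ind (P : int -> Prop) : P 0 -> (forall n, P n -> P (n + 1)) ->
  (forall n, P n -> P (n - 1)) -> forall n, P n.
Proof.
move=> P0 PS PB; elim=> [//|n /PS|n /PB].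
- by have -> : n%:Z + 1 = n.+1 by lia.
- by have -> : - n%:Z - 1 = - n.+1%:Z by lia.
Qed.

Lemma zitD m n x : zit g (m + n) x = zit g m (zit g n x).
Proof.
elim/int_step_ind: m => [|m IHm|m IHm]; first by rewrite add0r.
- by rewrite zitS -IHm -zitS addrAC.
- by rewrite zitB -IHm -zitB addrAC.
Qed.

Lemma zit_le n x y : (zit g n x <= zit g n y) = (x <= y).
Proof.
elim/int_step_ind: n => [//|n IHn|n IHn]; first by rewrite !zitS af_le.
by rewrite !zitB ainv_le.
Qed.

Lemma orbital_refl x : orbital g x x.
Proof. by exists 0, 0. Qed.

Lemma orbital_sym x y : orbital g x y -> orbital g y x.
Proof.
move=> [m [n [ny my]]]; exists (- n), (- m).
by split; [rewrite -(zit_le m)|rewrite -(zit_le n)]; rewrite -zitD subrr.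
Qed.

Lemma orbital_trans x y z : orbital g x y -> orbital g y z -> orbital g x z.
Proof.
move=> [m [n [ny my]]] [m' [n' [nz mz]]]; exists (m' + m), (n' + n); rewrite !zitD; split.
  by apply: le_trans nz; rewrite zit_le.
by apply: le_trans mz _; rewrite zit_le.
Qed.

Lemma orbital_eq x y : orbital g x y -> orbital g x = orbital g y.
Proof.
move=> xy; apply: pred_ext => z; split; last exact: orbital_trans xy.
exact: orbital_trans (orbital_sym xy).
Qed.

Lemma orbital_of_eq x y : orbital g x = orbital g y -> orbital g x y.
Proof. by move=> ->; apply: orbital_refl. Qed.

Lemma orbital_convex x a b q : orbital g x a -> orbital g x b -> a <= q -> q <= b -> orbital g x q.
Proof.
move=> [_ [n [na _]]] [m [_ [_ mb]]] aq qb; exists m, n.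
by rewrite (le_trans na aq) (le_trans qb mb).
Qed.

Lemma orbital_af x : orbital g x (g x).
Proof. by exists 1, 1. Qed.

Lemma orbital_ainv x : orbital g x (ainv g x).
Proof. by exists (-1), (-1). Qed.

(** Orbitals are convex classes of an equivalence relation, so distinct ones cannot interleave. *)
Lemma orbitals_lt x y : x < y -> orbital g x = orbital g y \/ setlt (orbital g x) (orbital g y).
Proof.
move=> xy; case: (classic (orbital g x y)) => [/orbital_eq|nxy]; [by left|right].
move=> a b xa yb; rewrite ltNge; apply/negP => ba; apply: nxy.
case: (leP x b) => xb.
  exact: orbital_trans (orbital_convex (orbital_refl x) xa xb ba) (orbital_sym yb).
exact/orbital_sym/(orbital_convex yb (orbital_refl y) (ltW xb) (ltW xy)).
Qed.

Lemma setlt_orbital x y : setlt (orbital g x) (orbital g y) -> x < y.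
Proof. by apply; apply: orbital_refl. Qed.

(** A point [y] that does not move up is a barrier: all iterates of an upward moving [x] stay on the
    side of [y] where [x] lies. *)
Lemma up_orbital x y : x < g x -> g y <= y -> ~ orbital g x y.
Proof.
move=> xgx gyy [m [n [nxy ymx]]].
have up k : zit g k x < g (zit g k x).
  by elim/int_step_ind: k => [//|k IHk|k IHk]; rewrite ?zitS ?af_lt // zitB ainv_K -af_lt ainv_K.
case: (ltgtP x y) => [xy|yx|exy]; last by rewrite exy ltNge gyy in xgx.
  have : zit g m x < y; last by rewrite ltNge ymx.
  elim/int_step_ind: m {ymx} => [//|k IHk|k IHk]; first by rewrite zitS (lt_le_trans _ gyy) ?af_lt.
  by rewrite zitB (lt_trans _ IHk) // -af_lt ainv_K.
have : y < zit g n x; last by rewrite ltNge nxy.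
elim/int_step_ind: n {nxy} => [//|k IHk|k IHk]; first by rewrite zitS (lt_trans IHk).
by rewrite zitB -af_lt ainv_K (le_lt_trans gyy).
Qed.

Lemma fixed_orbital x y : g x = x -> orbital g x y -> y = x.
Proof.
move=> gx [m [n [ny my]]].
have fix_zit k : zit g k x = x.
  by elim/int_step_ind: k => [//|k IHk|k IHk]; rewrite ?zitS ?zitB IHk // -{1}gx af_K.
by apply: le_anti; move: ny my; rewrite !fix_zit => -> ->.
Qed.

Lemma parityP x : match parity g x return Prop with
  | Plus => x < g x | Minus => g x < x | Zero => g x = x end.
Proof. by rewrite /parity /sgnc; case: ltgtP. Qed.

Lemma parity_plus x : x < g x -> parity g x = Plus.
Proof. by rewrite /parity /sgnc => ->. Qed.

Lemma parity_orbital x y : orbital g x y -> parity g x = parity g y.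
Proof.
move=> xy; have yx := orbital_sym xy; have := parityP x; have := parityP y.
case: (parity g x); case: (parity g y) => // hy hx.
- by case: (up_orbital hx (ltW hy)).
- by case: (@up_orbital x y hx) => //; rewrite hy.
- by case: (up_orbital hy (ltW hx)).
- by move: hx; rewrite (fixed_orbital hy yx) hy ltxx.
- by case: (@up_orbital y x hy) => //; rewrite hx.
- by move: hy; rewrite (fixed_orbital hx xy) hx ltxx.
Qed.

Lemma ocol_orbital x : ocol g (orbital g x) = parity g x.
Proof.
rewrite /ocol; case: excluded_middle_informative => [up|nup] /=.
  by case: up => y [xy /parity_plus]; rewrite (parity_orbital xy).
case: excluded_middle_informative => [down|ndown] /=.
  by case: down => y [xy gy]; rewrite (parity_orbital xy) /parity /sgnc gy ltNge ltW.
have := parityP x; case: (parity g x) => // h.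
  by case: nup; exists x; split=> //; apply: orbital_refl.
by case: ndown; exists x; split=> //; apply: orbital_refl.
Qed.

Lemma orbital_color_neq0 x y : orbital g x y -> x < y -> parity g x <> Zero.
Proof.
by move=> xy lxy e; have := parityP x; rewrite e => /fixed_orbital/(_ xy) eyx; rewrite eyx ltxx in lxy.
Qed.

Lemma orbitals_colored_order : colored_order (Orbitals g) setlt (ocol g).
Proof.
split.
- by move=> _ [x ->] /setlt_orbital; rewrite ltxx.
- move=> I _ K _ [y ->] _ xy yz a b xa zb.
  by apply: lt_trans (yz y b (orbital_refl y) zb); apply: xy => //; apply: orbital_refl.
- move=> _ _ [x ->] [y ->]; case: (ltgtP x y) => [/orbitals_lt|/orbitals_lt|->]; [tauto| |tauto].
  by move=> [->|]; tauto.
- move=> _ _ [x ->] [y ->]; rewrite !ocol_orbital => kx ky /setlt_orbital xy.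
  (* The midpoint lies in neither orbital, since the orbital of a fixed point is a singleton. *)
  have [xm my] : x < (x + y) / 2%:R /\ (x + y) / 2%:R < y by lra.
  exists (orbital g ((x + y) / 2%:R)); split; first by eexists.
    case: (orbitals_lt xm) => // /orbital_of_eq /orbital_color_neq0.
    by move=> /(_ xm); rewrite kx.
  case: (orbitals_lt my) => // /orbital_of_eq H; have := orbital_color_neq0 H my.
  by rewrite (parity_orbital H) ky.
Qed.

Lemma representatives : exists rep : (rat -> Prop) -> rat,
  forall I, Orbitals g I -> I = orbital g (rep I).
Proof. exact: (choice_fun_in 0 (P := Orbitals g) (R := fun I x => I = orbital g x)). Qed.

(** * Partial orbitals as subsets of orbitals *)

Section PartialOrbitals.
Variable A : seq rat.

Lemma ppar_in a : a \in A -> ppar g A a = Some (parity g a).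
Proof. by rewrite /ppar => ->. Qed.

(** Each inequality places one point between the other and its image or preimage, all within one
    convex orbital. *)
Lemma prel_orbital a b : prel g A a b -> orbital g a b.
Proof.
have inv_convex a' b' : ainv g a' <= b' -> b' <= a' -> orbital g a' b'.
  exact: orbital_convex (orbital_ainv a') (orbital_refl a').
have af_convex a' b' : a' <= b' -> b' <= g a' -> orbital g a' b'.
  exact: orbital_convex (orbital_refl a') (orbital_af a').
have inv_convex' a' b' : a' <= b' -> b' <= ainv g a' -> orbital g a' b'.
  exact: orbital_convex (orbital_refl a') (orbital_ainv a').
have af_convex' a' b' : g a' <= b' -> b' <= a' -> orbital g a' b'.
  exact: orbital_convex (orbital_af a') (orbital_refl a').
case=> [->|[[_ H]|[_ H]]]; first exact: orbital_refl.
  by case: H => [|[|[|]]] [_ [h1 h2]]; first [by auto|by apply: orbital_sym; auto].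
by case: H => [|[|[|]]] [_ [h1 h2]]; first [by auto|by apply: orbital_sym; auto].
Qed.

Lemma psim_orbital a b : psim g A a b -> orbital g a b.
Proof.
elim=> [x y /prel_orbital//|x|x y _|x y z _ xy _ yz]; first exact: orbital_refl.
  exact: orbital_sym.
exact: orbital_trans xy yz.
Qed.

Lemma pclass_refl a : pclass g A a a.
Proof. exact: rst_refl. Qed.

Lemma setlt_pclass a b : setlt (orbital g a) (orbital g b) -> setlt (pclass g A a) (pclass g A b).
Proof. by move=> ab x y /psim_orbital ax /psim_orbital by_; apply: ab. Qed.

End PartialOrbitals.
End AutQ.

(** * Finite maps of orbitals obtained from partial orbitals and from conjugation *)

Definition orbital_fin_hom (rho gamma : autQ) : Prop :=
  fin_hom (Orbitals gamma) setlt (ocol gamma) (Orbitals rho) setlt (ocol rho).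

(** The set [A] consists of one representative per orbital of the family. Partial classes lie inside
    orbitals, so they inherit the order of the orbitals. *)
Lemma wp_hom_orbital_fin_hom rho gamma :
  (forall A, wp_hom_exists rho gamma A) -> orbital_fin_hom rho gamma.
Proof.
move=> hom n a Oa; have [rep repP] := representatives gamma.
pose A := mkseq (rep \o a) n; have [phi [Ophi [kphi [lephi zphi]]]] := hom A.
have inA i : (i < n)%N -> rep (a i) \in A by move=> ilt; apply: map_f; rewrite mem_iota.
have aE i : (i < n)%N -> a i = orbital gamma (rep (a i)) by move=> /Oa /repP.
exists (fun I => phi (pclass gamma A (rep I))); split=> [i ilt|i j ilt jlt].
  split; first exact/Ophi/inA.
  have := kphi _ (inA i ilt); rewrite ppar_in ?inA // => -[<-].
  by rewrite {2}aE // ocol_orbital.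
rewrite {1}(aE i ilt) {1}(aE j jlt) => ij; split.
  by apply: lephi; rewrite ?inA //; right; apply: setlt_pclass.
rewrite {1}(aE i ilt) {1}(aE j jlt) !ocol_orbital => ki kj /zphi.
rewrite !ppar_in ?inA // ki kj => /(_ isT isT erefl erefl) e.
have := pclass_refl gamma A (rep (a j)); rewrite -e => /psim_orbital /orbital_eq eo.
by move: ij; rewrite eo => /setlt_orbital; rewrite ltxx.
Qed.

(** Partial classes within one orbital all receive the same image, which weak monotonicity permits;
    for zeros this causes no clash because a fixed point is a whole orbital. *)
Lemma orbital_fin_hom_wp_hom rho gamma :
  orbital_fin_hom rho gamma -> forall A, wp_hom_exists rho gamma A.
Proof.
move=> hom A.
have [psi [psiP psile]] := hom (size A) (fun i => orbital gamma (nth 0 A i))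
  (fun i _ => ex_intro _ _ erefl).
have {}psiP a : a \in A -> Orbitals rho (psi (orbital gamma a))
    /\ ocol rho (psi (orbital gamma a)) = parity gamma a.
  by move=> aA; rewrite -ocol_orbital -(nth_index 0 aA); apply: psiP; rewrite index_mem.
have {}psile a b : a \in A -> b \in A -> setlt (orbital gamma a) (orbital gamma b) ->
    (psi (orbital gamma a) = psi (orbital gamma b)
      \/ setlt (psi (orbital gamma a)) (psi (orbital gamma b)))
    /\ (parity gamma a = Zero -> parity gamma b = Zero ->
      psi (orbital gamma a) <> psi (orbital gamma b)).
  move=> aA bA ab; have := psile (index a A) (index b A); rewrite !index_mem !nth_index //.
  by rewrite !ocol_orbital; apply.
(* Since [phi] acts on classes, a representative in [A] is chosen for each; its orbital does not
   depend on the choice. *)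
have [r rP] := choice_fun_in 0 (P := fun C => exists2 a, a \in A & C = pclass gamma A a)
  (R := fun C a => a \in A /\ C = pclass gamma A a)
  (fun C => fun '(ex_intro2 a aA e) => ex_intro _ a (conj aA e)).
pose phi C := psi (orbital gamma (r C)).
have phiE a : a \in A -> phi (pclass gamma A a) = psi (orbital gamma a).
  move=> aA; have [|rA er] := rP (pclass gamma A a); first by exists a.
  rewrite /phi; congr psi; apply/orbital_eq/(@psim_orbital _ A).
  by rewrite -/(pclass gamma A _ a) -er; apply: pclass_refl.
exists phi; split; [|split; [|split]].
- by move=> a aA; rewrite phiE //; case: (psiP a aA).
- by move=> a aA; rewrite phiE // ppar_in //; case: (psiP a aA) => _ ->.
- move=> a b aA bA; rewrite !phiE // => -[e|ab].
    left; congr psi; apply/orbital_eq/(@psim_orbital _ A).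
    by rewrite -/(pclass gamma A _ b) e; apply: pclass_refl.
  have lab : a < b by apply: ab; apply: pclass_refl.
  case: (orbitals_lt gamma lab) => [->|slt]; first by left.
  by case: (psile a b aA bA slt).
- move=> a b aA bA; rewrite !ppar_in // !phiE // => -[ka] [kb] e.
  case: (ltgtP a b) => [ab|ba|->//].
    case: (orbitals_lt gamma ab) => [/orbital_of_eq/orbital_color_neq0/(_ ab)//|slt].
    by case: (psile a b aA bA slt) => _ /(_ ka kb).
  case: (orbitals_lt gamma ba) => [/orbital_of_eq/orbital_color_neq0/(_ ba)//|slt].
  by case: (psile b a bA aA slt) => _ /(_ kb ka); rewrite e.
Qed.

Lemma sgnc_af (s : autQ) x y : sgnc (s x) (s y) = sgnc x y.
Proof. by rewrite /sgnc !af_lt. Qed.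

(** The inverse of the conjugator is applied to representatives. Agreement with [gamma] there
    preserves parity, and the order of points gives the weak order of their orbitals. *)
Lemma conj_closure_orbital_fin_hom rho gamma :
  in_conj_closure rho gamma -> orbital_fin_hom rho gamma.
Proof.
move=> cl n a Oa; have [rep repP] := representatives gamma.
have [s sP] := cl (mkseq (rep \o a) n).
have {}sP i : (i < n)%N -> s (rho (ainv s (rep (a i)))) = gamma (rep (a i)).
  by move=> ilt; apply: sP; apply: (map_f (rep \o a)); rewrite mem_iota.
have aE i : (i < n)%N -> a i = orbital gamma (rep (a i)) by move=> /Oa /repP.
have kE i : (i < n)%N -> parity rho (ainv s (rep (a i))) = parity gamma (rep (a i)).
  by move=> ilt; rewrite /parity -(sgnc_af s) sP // ainv_K.
exists (fun I => orbital rho (ainv s (rep I))); split=> [i ilt|i j ilt jlt].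
  by split; [eexists|rewrite ocol_orbital kE // {2}aE // ocol_orbital].
rewrite {1}(aE i ilt) {1}(aE j jlt) => /setlt_orbital; rewrite -(ainv_lt s) => ij.
split; first exact: orbitals_lt.
rewrite {1}(aE i ilt) ocol_orbital -kE // => ki _ /orbital_of_eq /orbital_color_neq0.
by move=> /(_ ij).
Qed.
(** * Realizing finite maps of orbitals by conjugation *)

Lemma exists_between (m : rat) (l : seq rat) : (forall y, y \in l -> m < y) ->
  exists v, m < v /\ forall y, y \in l -> v < y.
Proof.
elim: l => [|y l IHl] H; first by exists (m + 1); split=> //; lra.
have [z zl|v [mv vl]] := IHl; first by apply: H; rewrite inE zl orbT.
have my : m < y by apply: H; rewrite inE eqxx.
exists (Num.min v ((m + y) / 2%:R)); split; first by rewrite lt_min mv; lra.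
move=> z; rewrite inE gt_min => /orP[/eqP->|/vl ->//].
by apply/orP; right; lra.
Qed.

(** Decreasing order makes list induction add the greatest point last. *)
Lemma sorted_down_list (l : seq rat) : exists s : seq rat, sorted >%R s /\ s =i l.
Proof.
exists (rev (sort <=%R (undup l))); split.
  by rewrite rev_sorted -/(sorted <%R _) sort_lt_sorted undup_uniq.
by move=> x; rewrite mem_rev mem_sort mem_undup.
Qed.

(* [f] is built upwards along [s]: the image of a new point [b] is forced to be [rho (f a)] when
   [b = g a], and otherwise can be any point above the previous images that stays below [rho (f a)]
   for all [a] with [b < g a]. The last clause is the invariant that makes this possible. *)
Lemma up_embedding (rho g : autQ) (y0 : rat) (A s : seq rat) :
  y0 < rho y0 -> (forall a, a \in A -> a < g a) -> sorted >%R s ->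
  (forall a, a \in A -> g a \in s -> a \in s) ->
  exists f : rat -> rat,
  [/\ forall x, x \in s -> orbital rho y0 (f x),
      {in s &, forall x y, x < y -> f x < f y},
      forall a, a \in A -> g a \in s -> f (g a) = rho (f a)
    & forall a x, a \in A -> a \in s -> x \in s -> x < g a -> f x < rho (f a)].
Proof.
move=> up0 upA.
have up v : orbital rho y0 v -> v < rho v.
  by move=> /parity_orbital kv; have := parityP rho v; rewrite -kv parity_plus.
elim: s => [|b s IHs] srt clo; first by exists id.
have bmax x : x \in s -> x < b.
  by move: srt; rewrite /= (path_sortedE (rev_trans lt_trans)) => /andP[/allP H _] /H.
have bNs : b \notin s by apply/negP => /bmax; rewrite ltxx.
(* The tail is again closed: if [g a] lies in it, then [a < g a < b] excludes [a = b]. *)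
have [a aA gas|f [forb flt feq finv]] := IHs (path_sorted srt).
  have := clo a aA; rewrite inE gas orbT inE => /(_ isT) /orP[/eqP eab|//].
  by have := upA a aA; have := bmax _ gas; rewrite eab => /lt_trans h /h; rewrite ltxx.
suff [v [vorb vgt veq vinv]] : exists v, [/\ orbital rho y0 v, forall x, x \in s -> f x < v,
    forall a, a \in A -> a \in s -> g a = b -> v = rho (f a)
    & forall a, a \in A -> a \in s -> b < g a -> v < rho (f a)].
  exists (fun x => if x == b then v else f x).
  have fE x : x \in s -> (if x == b then v else f x) = f x.
    by case: eqP => // ->; rewrite (negPf bNs).
  split.
  - by move=> x; rewrite inE => /orP[/eqP->|xs]; rewrite ?eqxx ?fE //; apply: forb.
  - move=> x y; rewrite !inE => /orP[/eqP->|xs] /orP[/eqP->|ys].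
    + by rewrite ltxx.
    + by move=> /(lt_trans (bmax y ys)); rewrite ltxx.
    + by move=> _; rewrite eqxx fE //; apply: vgt.
    + by rewrite !fE //; apply: flt.
  - move=> a aA gab; have := clo a aA gab; rewrite inE => /orP[/eqP eab|as_].
      have := upA a aA; move: gab; rewrite inE eab => /orP[/eqP->|/bmax /lt_trans h /h]; by rewrite ltxx.
    move: gab; rewrite inE (fE a as_) => /orP[/eqP gab|gas]; last by rewrite fE //; apply: feq.
    by rewrite gab eqxx; apply: veq.
  - move=> a x aA; rewrite !inE => /orP[/eqP eab|as_] /orP[/eqP->|xs] xga.
    + by rewrite eab eqxx; apply: up.
    + by rewrite eab eqxx fE //; apply: lt_trans (up _ vorb); apply: vgt.
    + by rewrite eqxx fE //; apply: vinv.
    + by rewrite !fE //; apply: finv.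
have [[a [aA as_ gab]]|nforced] := classic (exists a, [/\ a \in A, a \in s & g a = b]).
  exists (rho (f a)); split.
  - exact: orbital_trans (forb a as_) (orbital_af _ _).
  - by move=> x xs; apply: finv => //; rewrite gab bmax.
  - move=> a' _ _ ga'b; congr (rho (f _)).
    by rewrite -[a](af_K g) -[a'](af_K g) gab ga'b.
  - move=> a' a'A a's; rewrite -gab af_lt => aa'; rewrite af_lt; exact: flt.
have [noA|[c [cs cmax]]] : (forall x, x \notin s) \/ exists c, c \in s /\ forall x, x \in s -> x <= c.
  case: (s) (path_sorted srt) => [|c s'] /= srt'; [by left|right; exists c].
  rewrite inE eqxx; split=> // x; rewrite inE => /orP[/eqP->//|xs'].
  by move: srt'; rewrite (path_sortedE (rev_trans lt_trans)) => /andP[/allP /(_ x xs') /ltW].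
  exists y0; split=> [|x xs|a _ as_|a _ as_]; first exact: orbital_refl.
  - by have := noA x; rewrite xs.
  - by have := noA a; rewrite as_.
  - by have := noA a; rewrite as_.
(* With [rho (f c)] among the upper bounds, [v] lies between two points of the orbital and hence in
   it. *)
have [y|v [mv vl]] := @exists_between (f c)
    (rho (f c) :: [seq rho (f a) | a <- [seq a <- A | (a \in s) && (b < g a)]]).
  rewrite inE => /orP[/eqP->|]; first exact/up/forb.
  case/mapP => a; rewrite mem_filter => /andP[/andP[as_ bga] aA] ->.
  by apply: finv => //; apply: lt_trans (bmax c cs) bga.
exists v; split.
- have vrho : v < rho (f c) by apply: vl; rewrite inE eqxx.
  apply: orbital_convex (forb c cs) _ (ltW mv) (ltW vrho).
  exact: orbital_trans (forb c cs) (orbital_af _ _).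
- move=> x xs; apply: le_lt_trans mv; have := cmax x xs; rewrite le_eqVlt.
  by move=> /orP[/eqP->//|xc]; apply/ltW/flt.
- by move=> a aA as_ gab; case: nforced; exists a.
- move=> a aA as_ bga; apply: vl; rewrite inE; apply/orP; right.
  by apply: map_f; rewrite mem_filter as_ bga aA.
Qed.

Definition autQ_inv (g : autQ) : autQ :=
  AutQ (fun x y => etrans (ainv_lt g x y)) (ainv_K g) (af_K g).

Lemma orbital_inv (g : autQ) x y : orbital (autQ_inv g) x y -> orbital g x y.
Proof.
have zitN k z : zit (autQ_inv g) k z = zit g (- k) z.
  elim/int_step_ind: k => [//|k IHk|k IHk]; first by rewrite zitS IHk opprD zitB.
  by rewrite zitB IHk opprB addrC zitS.
by move=> [m [n]]; rewrite !zitN => H; exists (- m), (- n).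
Qed.

(** Passing to the inverses of [rho] and [g] turns downward motion into upward motion; [A] is then
    replaced by its image under [g]. *)
Lemma down_embedding (rho g : autQ) (y0 : rat) (A s : seq rat) :
  rho y0 < y0 -> (forall a, a \in A -> g a < a) -> sorted >%R s ->
  (forall a, a \in A -> a \in s -> g a \in s) ->
  exists f : rat -> rat,
  [/\ forall x, x \in s -> orbital rho y0 (f x),
      {in s &, forall x y, x < y -> f x < f y}
    & forall a, a \in A -> a \in s -> f (g a) = rho (f a)].
Proof.
move=> down0 downA srt clo.
have [||_ /mapP[a aA ->]|f [forb flt feq _]] :=
  @up_embedding (autQ_inv rho) (autQ_inv g) y0 [seq g a | a <- A] s _ _ srt.
- by rewrite /= -(af_lt rho) ainv_K.
- by move=> _ /mapP[a aA ->]; rewrite /= af_K downA.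
- by rewrite /= af_K; apply: clo.
exists f; split=> // [x /forb /orbital_inv//|a aA as_].
have := feq (g a); rewrite /= af_K => -> //; last exact: map_f.
by rewrite ainv_K.
Qed.

(** Scaling only the part above [c] adjusts the value at a new greatest point without disturbing the
    values already fixed. *)
Lemma stretch_exists (c k : rat) : 0 < k -> exists h : autQ,
  forall x, h x = if x <= c then x else c + (x - c) * k.
Proof.
move=> k0; pose h k x : rat := if x <= c then x else c + (x - c) * k.
have h_gt l x : 0 < l -> c < x -> c < h l x.
  by move=> l0 cx; rewrite /h leNgt cx /= ltrDl mulr_gt0 ?subr_gt0.
have hK l x : 0 < l -> h l^-1 (h l x) = x.
  move=> l0; case: (leP x c) => cx; first by rewrite /h !cx.
  rewrite {1}/h leNgt h_gt //= /h leNgt cx /=.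
  have -> : c + (x - c) * l - c = (x - c) * l by ring.
  by rewrite mulfK ?gt_eqF // addrC subrK.
have h_lt x y : x < y -> h k x < h k y.
  move=> xy; case: (leP y c) => cy; first by rewrite /h cy (le_trans (ltW xy) cy).
  case: (leP x c) => cx; first by apply: le_lt_trans (h_gt _ _ k0 cy); rewrite /h cx.
  by rewrite /h !leNgt cx cy /= ltrD2l ltr_pM2r // ltrD2r.
have hK' x : h k (h k^-1 x) = x by rewrite -{1}[k]invrK hK ?invr_gt0.
by exists (AutQ h_lt (fun x => hK k x k0) hK').
Qed.

Lemma autQ_comp_exists (g h : autQ) : exists f : autQ, forall x, f x = g (h x).
Proof.
have lt' x y : x < y -> g (h x) < g (h y) by rewrite !af_lt.
have K x : ainv h (ainv g (g (h x))) = x by rewrite !af_K.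
have K' x : g (h (ainv h (ainv g x))) = x by rewrite !ainv_K.
by exists (AutQ lt' K K').
Qed.

Lemma translation_exists (d : rat) : exists h : autQ, forall x, h x = x + d.
Proof.
have lt' x y : x < y -> x + d < y + d by rewrite ltrD2r.
by exists (AutQ lt' (addrK d) (subrK d)).
Qed.

Lemma finite_extension (t : rat -> rat) (s : seq rat) : sorted >%R s ->
  {in s &, forall x y, x < y -> t x < t y} -> exists h : autQ, {in s, forall x, h x = t x}.
Proof.
elim: s => [|b s IHs] srt tlt; first by have [h _] := translation_exists 0; exists h.
have bmax x : x \in s -> x < b.
  by move: srt; rewrite /= (path_sortedE (rev_trans lt_trans)) => /andP[/allP H _] /H.
have [x y xs ys|h hP] := IHs (path_sorted srt).
  by apply: tlt; rewrite inE ?xs ?ys orbT.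
case: s => [|c s] in srt tlt bmax hP {IHs} *.
  have [d dP] := translation_exists (t b - b); exists d => x.
  by rewrite inE => /eqP->; rewrite dP addrC subrK.
have cb : c < b by apply: bmax; rewrite inE eqxx.
have hc : h c = t c by apply: hP; rewrite inE eqxx.
have cmax x : x \in c :: s -> x <= c.
  rewrite inE => /orP[/eqP->//|xs].
  by move: (path_sorted srt); rewrite /= (path_sortedE (rev_trans lt_trans)) => /andP[/allP /(_ x xs) /ltW].
have hcb : h c < h b by rewrite af_lt.
have tcb : t c < t b by apply: tlt; rewrite ?inE ?eqxx ?orbT.
(* The factor is the one that sends [h b] to [t b] while fixing [h c = t c]. *)
have [|m mP] := @stretch_exists (h c) ((t b - t c) / (h b - h c)).
  by rewrite divr_gt0 ?subr_gt0.
have [f fP] := autQ_comp_exists m h; exists f => x; rewrite inE fP mP => /orP[/eqP->|xs].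
  rewrite leNgt hcb /= mulrC divfK ?subr_eq0 ?gt_eqF //.
  by rewrite hc addrC subrK.
by rewrite af_le cmax // hP.
Qed.

(** Points of [A] and their images are placed inside the assigned orbitals of [rho] so that [gamma]
    becomes [rho]; the resulting finite increasing map extends to an automorphism. *)
Lemma orbital_fin_hom_conj_closure rho gamma :
  orbital_fin_hom rho gamma -> in_conj_closure rho gamma.
Proof.
move=> hom A.
have [psi [psiP psile]] := hom (size A) (fun i => orbital gamma (nth 0 A i))
  (fun i _ => ex_intro _ _ erefl).
have [s [srt sE]] := sorted_down_list (A ++ [seq gamma a | a <- A]).
have As a : a \in A -> a \in s /\ gamma a \in s.
  by move=> aA; rewrite !sE !mem_cat aA map_f // orbT.
have sA x : x \in s -> exists2 i, (i < size A)%N & orbital gamma x = orbital gamma (nth 0 A i).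
  rewrite sE mem_cat => /orP[xA|/mapP[a aA ->]].
    by exists (index x A); rewrite ?index_mem ?nth_index.
  exists (index a A); rewrite ?index_mem ?nth_index //.
  exact/esym/orbital_eq/orbital_af.
have {}psiP x : x \in s -> Orbitals rho (psi (orbital gamma x))
    /\ ocol rho (psi (orbital gamma x)) = parity gamma x.
  by move=> xs; rewrite -ocol_orbital; have [i ilt ->] := sA x xs; apply: psiP.
have {}psile x y : x \in s -> y \in s -> setlt (orbital gamma x) (orbital gamma y) ->
    (psi (orbital gamma x) = psi (orbital gamma y)
      \/ setlt (psi (orbital gamma x)) (psi (orbital gamma y)))
    /\ (parity gamma x = Zero -> parity gamma y = Zero ->
      psi (orbital gamma x) <> psi (orbital gamma y)).
  move=> xs ys; rewrite -!ocol_orbital; have [i ilt ->] := sA x xs; have [j jlt ->] := sA y ys.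
  exact: psile.
(* One [f] per target orbital is defined on all of [s], so orbitals of [gamma] with the same image
   are placed in the right order. *)
have embed J : Orbitals rho J -> exists f : rat -> rat,
    [/\ forall x, x \in s -> J (f x),
        ocol rho J <> Zero -> {in s &, forall x y, x < y -> f x < f y}
      & forall a, a \in A -> parity gamma a = ocol rho J -> f (gamma a) = rho (f a)].
  move=> [y0 ->]; rewrite ocol_orbital; have := parityP rho y0.
  case: (parity rho y0) => h0.
  - have [a|a|f [forb flt feq _]] :=
      @up_embedding rho gamma y0 [seq a <- A | a < gamma a] s h0 _ srt.
    + by rewrite mem_filter => /andP[].
    + by rewrite mem_filter => /andP[_ /As []].
    exists f; split=> // a aA ka; have := parityP gamma a; rewrite ka => ga.
    by apply: feq; [rewrite mem_filter ga|case: (As a aA)].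
  - have [a|a|f [forb flt feq]] :=
      @down_embedding rho gamma y0 [seq a <- A | gamma a < a] s h0 _ srt.
    + by rewrite mem_filter => /andP[].
    + by rewrite mem_filter => /andP[_ /As []].
    exists f; split=> // a aA ka; have := parityP gamma a; rewrite ka => ga.
    by apply: feq; [rewrite mem_filter ga|case: (As a aA)].
  (* A fixed point of [rho] leaves a single place, and the order clause excludes this case. *)
  - by exists (fun _ => y0); split=> // *; apply: orbital_refl.
have [F FP] := choice_fun_in id embed.
pose t x := F (psi (orbital gamma x)) x.
have tlt : {in s &, forall x y, x < y -> t x < t y}.
  move=> x y xs ys xy; have [Ox kx] := psiP x xs; have [Oy ky] := psiP y ys.
  have [tx fx _] := FP _ Ox; have [ty _ _] := FP _ Oy.
  have same : psi (orbital gamma x) = psi (orbital gamma y) -> parity gamma x <> Zero -> t x < t y.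
    by move=> e nz; rewrite /t -e; apply: fx => //; rewrite kx.
  case: (orbitals_lt gamma xy) => [e|/(psile x y xs ys) [[e|slt] nz]].
  - by apply: same; [rewrite e|apply: orbital_color_neq0 (orbital_of_eq e) xy].
  (* Two different orbitals with a common image cannot be zeros, by injectivity on zeros. *)
  - by apply: same => // kx0; apply: nz => //; rewrite -ky -e kx.
  - by apply: slt; [apply: tx|apply: ty].
have [h hP] := finite_extension srt tlt.
have lt' x y : x < y -> ainv h x < ainv h y by rewrite ainv_lt.
(* The map [h] leads from points of [gamma] to points of [rho], so the conjugator is its inverse. *)
exists (autQ_inv h) => a aA; have [as_ gas] := As a aA.
have [Oa ka] := psiP a as_; have [_ _ eqa] := FP _ Oa.
rewrite /= hP // /t -eqa //; apply: (can_inj (ainv_K (autQ_inv h))) => /=.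
rewrite ainv_K hP // /t; congr (F (psi _) _); apply/orbital_eq/orbital_af.
Qed.

Theorem theorem3p1 (rho gamma : autQ) :
  (in_conj_closure rho gamma <-> (forall A : seq rat, wp_hom_exists rho gamma A))
  /\ ((forall A : seq rat, wp_hom_exists rho gamma A) <-> cond3 rho gamma).
Proof.
have cog := orbitals_colored_order gamma; have cor := orbitals_colored_order rho.
split; split.
- by move=> /conj_closure_orbital_fin_hom /orbital_fin_hom_wp_hom.
- by move=> /wp_hom_orbital_fin_hom /orbital_fin_hom_conj_closure.
- move=> /wp_hom_orbital_fin_hom hom.
  case: (classic (O_inf3 rho)) => rinf; [by left|right].
  have ginf : ~ O_inf3 gamma by move=> /(fin_hom_inf3 hom).
  split=> //; split=> //.
  have [Lg [cg [dg cang]]] := canonical_decomposition_exists cog ginf.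
  have [Lr [cr [dr canr]]] := canonical_decomposition_exists cor rinf.
  exists Lg, cg, Lr, cr; do 4![split=> //].
  (* The empty set is only a default value for choice functions. *)
  exact: (fin_hom_chi_hom cog cor (fun _ => False) dg dr hom).
- move=> H; apply: orbital_fin_hom_wp_hom.
  case: H => [|[_ [_ [Lg [cg [Lr [cr [dg [cang [dr [_ hom]]]]]]]]]]]; first exact: inf3_fin_hom.
  exact: (chi_hom_fin_hom cog cor (fun _ => False) dg cang dr hom).
Qed.
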